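(* Let $k\geqslant 1$, let $S$ be a $\mathrm{GM}$ semigroup with corresponding transformation semigroup $(G\times B,S)$, and let $L$ be either $Rh_B(G)$ or $\mathrm{SP}(G\times B)$. If $\mathrm{RLM}(S)c=k$ and some state of $\mathrm{Eval}_{k-1}(L)$ is a contradiction, then $Sc=k+1$.
   Context: All semigroups are finite. COMPLEXITY. $S$ divides $T$ if $S$ is a quotient of a subsemigroup of $T$. $Sc$ is the least $n$ such that $S$ divides an iterated wreath product $A_n\wr G_n\wr\cdots\wr A_1\wr G_1\wr A_0$ with $A_i$ finite aperiodic semigroups (only trivial subgroups) and $G_i$ finite groups. $C_k$ is the class of all finite semigroups of complexity at most $k$. GM SEMIGROUPS. $S$ is a $\mathrm{GM}$ (group mapping) semigroup if it has a unique $0$-minimal ideal $I(S)$, this ideal is a regular Rees matrix semigroup $M^0(A,G,B,C)$ with $G$ a non-trivial group, and the right (left) Schützenberger representation of $S$ on some (equivalently any) non-zero $\mathcal R$- ($\mathcal L$-) class of $I(S)$ is faithful. Identifying a non-zero $\mathcal R$-class of $I(S)$ with $G\times B$, $S$ acts faithfully on the right of $G\times B$ by partial functions ($(g,b)s$ is undefined if the product is $0$); this is $(G\times B,S)$. It commutes with the left action $g(h,b)=(gh,b)$. It induces an action of $S$ by partial functions on $B$; $\mathrm{RLM}(S)$ is the image of $S$ in the partial transformations of $B$. Fix a generating set $X$ of $S$. LATTICES. $\mathrm{SP}(G\times B)$ is the lattice of all pairs $(Y,\Pi)$ with $Y\subseteq G\times B$ and $\Pi$ a partition of $Y$; $(Y,\Pi)\leqslant(Z,\Theta)$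 if $Y\subseteq Z$ and each $\Pi$-class is contained in a $\Theta$-class. $(Y,\Pi)$ is a cross-section if no $\Pi$-class contains $(g,b),(h,b)$ with $g\ne h$; otherwise it is a contradiction. $(Y,\Pi)$ is invariant if it is fixed by the induced left action of every $g\in G$. The Rhodes lattice $Rh_B(G)$ is identified with the lattice of invariant cross-sections of $\mathrm{SP}(G\times B)$ (with the induced order) together with an added top element $\Longrightarrow\Longleftarrow$, which is the (only) contradiction of $Rh_B(G)$; the join of two invariant cross-sections is their join in $\mathrm{SP}(G\times B)$ if that is a cross-section, and $\Longrightarrow\Longleftarrow$ otherwise. CLOSURE OPERATORS. For a finite lattice $L$, a closure operator on $L^2=L\times L$ is identified with its set of stable (closed) pairs, a meet-closed subset of $L^2$ containing the top, i.e. a binary relation on $L$. The set $\mathcal C(L^2)$ of these is a monoid under composition of binary relations. For $f\in\mathcal C(L^2)$: $\mathrm{Dom}(f)=\{l\mid\exists l',\,(l,l')\in f\}$; $\overleftarrow f=\{(l,l)\mid l\in\mathrm{Dom}(f)\}$; $f^{\star}=f\cap\{(l,l)\mid l\in L\}$; $f^\omega$ is the idempotent power of $f$; $f^{\omega+\star}=f^\omega f^\star$, so $(l,l')\in f^{\omega+\star}$ iff $(l,l')\in f^\omega$ and $(l',l')\in f$. For $x\in X$, the free flow $f_x$ along $x$ is the set of pairs $((Y,\Pi),(Z,\Theta))\in L^2$ such that (1) $Yx\subseteq Z$ and (2) for $y,y'\in Y$ with $yx,y'x$ both defined, $y,y'$ are in the same $\Pi$-class iff $yx,y'x$ are in the same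 $\Theta$-class; together with, for $L=Rh_B(G)$, the pair $(\Longrightarrow\Longleftarrow,\Longrightarrow\Longleftarrow)$. FLOW MONOID. A subset of a semigroup $M$ is pointlike with respect to $C_k$ if for every relational morphism $r\colon M\to T$ with $T\in C_k$ it is contained in $tr^{-1}$ for some $t\in T$. Every maximal subgroup of $M$ has a unique largest subgroup that is pointlike with respect to $C_k$. For $k\geqslant0$, $F_k(L)$ is the smallest subset $M$ of $\mathcal C(L^2)$ such that: the identity is in $M$; $f_x\in M$ for all $x\in X$; $M$ is closed under products; $f\in M$ implies $\overleftarrow f\in M$; and if $f\in M$ belongs to the largest subgroup, pointlike with respect to $C_k$ in $M$, of a maximal subgroup of $M$, then $f^{\omega+\star}\in M$. EVALUATION TRANSFORMATION SEMIGROUP. The vacuum $V$ is the join (as closure operators; equivalently, the intersection as relations) of all $\overleftarrow f$, $f\in F_k(L)$; it is an idempotent of $F_k(L)$. Let $LV=\bigcap_{f\in F_k(L)}\mathrm{Dom}(f)$. The monoid $VF_k(L)V$ acts on $LV$ by $l\cdot f=\min\{l''\mid(l,l'')\in f\}$. Fix $b_0\in B$. The start state is $\sigma=(\{(1,b_0)\},\{\{(1,b_0)\}\})$ for $L=\mathrm{SP}(G\times B)$, and the element $G\sigma$ with set $G\times\{b_0\}$ and singleton partition for $L=Rh_B(G)$ (more precisely, the least element of $LV$ above it). $\mathrm{States}_k(L)$ is the orbit of the start state under $VF_k(L)V$, $E_k(L)$ is the image of $VF_k(L)V$ acting on $\mathrm{States}_k(L)$, and $\mathrm{Eval}_k(L)=(\mathrm{States}_k(L),E_k(L))$.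 *)

(* Defs.v *)
From HB Require Import structures.
From mathcomp Require Import all_boot all_order all_fingroup.
From mathcomp Require Import boolp.

Set Implicit Arguments.
Unset Strict Implicit.
Unset Printing Implicit Defensive.

Import Order.TTheory.

Declare Scope semigroup_scope.
Delimit Scope semigroup_scope with S.
Local Open Scope semigroup_scope.

(* Not the join of semigroupType and finType: HB rejects that structure
   because finStarMonoidType already is the join of countType and magmaType. *)
HB.mixin Record isFinSemigroup S of Finite S := {
  smul : S -> S -> S;
  smulA : associative smul
}.

#[short(type="finSemigroupType")]
HB.structure Definition FinSemigroup := {S of isFinSemigroup S & Finite S}.

Notation "x ** y" := (smul x y) (at level 40, left associativity)
  : semigroup_scope.

Definition group_sg (G : finGroupType) : Type := G.
HB.instance Definition _ (G : finGroupType) := Finite.on (group_sg G).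
HB.instance Definition _ (G : finGroupType) :=
  isFinSemigroup.Build (group_sg G) (@mulgA G).

(* Semigroups that live inside an ambient one are handled as subsets, as in
   fingroup: P : {set U} is a semigroup when smul_closed P, and a semigroup
   type S is also seen as [set: S]. *)

Definition smul_closed (U : finSemigroupType) (P : {set U}) : Prop :=
  {in P &, forall x y, x ** y \in P}.

Section Subsemigroups.
Variable U : finSemigroupType.
Implicit Types H M P : {set U}.

Definition subgroup_set H : Prop :=
  smul_closed H /\
  exists2 e, e \in H &
    {in H, forall x, [/\ e ** x = x, x ** e = x
                       & exists2 y, y \in H & x ** y = e /\ y ** x = e]}.

Definition maximal_subgroup M H : Prop :=
  [/\ subgroup_set H, H \subset M
    & forall H', subgroup_set H' -> H' \subset M -> H \subset H' -> H' = H].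

Definition generates (X : {set U}) : Prop :=
  forall P, smul_closed P -> X \subset P -> P = [set: U].

Definition divides P (T : finSemigroupType) : Prop :=
  exists (D : {set T}) (h : T -> U),
    [/\ smul_closed D, {in D &, {morph h : x y / x ** y}} & h @: D = P].

End Subsemigroups.

Definition aperiodic (S : finSemigroupType) : Prop :=
  forall H : {set S}, subgroup_set H -> #|H| = 1%N.

Record tsemigroup := TSemigroup {
  states : finType;
  elements : finSemigroupType;
  tact : states -> elements -> states;
  tactM : forall q s t, tact q (s ** t) = tact (tact q s) t
}.

(* The right regular transformation semigroup (S^I, S), where S^I is S with a
   new identity, here None, adjoined. *)
Section Regular.
Variable S : finSemigroupType.

Definition regular_act (q : option S) (s : S) : option S :=
  Some (if q is Some x then x ** s else s).

Lemma regular_actM q s t :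
  regular_act q (s ** t) = regular_act (regular_act q s) t.
Proof. by case: q => [x|] //=; rewrite /regular_act smulA. Qed.

Definition regular : tsemigroup := TSemigroup regular_actM.
End Regular.

(* (Q, S) wr (P, T) = (Q x P, S^P x| T), with
   (f, t)(f', t') = (p |-> f p * f' (p t), t t'). *)
Section Wreath.
Variables Y X : tsemigroup.

Definition wreath_sg : Type := ({ffun states X -> elements Y} * elements X)%type.
HB.instance Definition _ := Finite.on wreath_sg.

Definition wreath_mul (u v : wreath_sg) : wreath_sg :=
  ([ffun p => u.1 p ** v.1 (tact p u.2)], u.2 ** v.2).

Lemma wreath_mulA : associative wreath_mul.
Proof.
move=> [f s] [g t] [h u]; rewrite /wreath_mul /=; congr (_, _); last first.
  exact: smulA.
by apply/ffunP => p; rewrite !ffunE tactM smulA.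
Qed.

HB.instance Definition _ := isFinSemigroup.Build wreath_sg wreath_mulA.

Definition wreath_act (q : states Y * states X) (u : wreath_sg) :=
  (tact q.1 (u.1 q.2), tact q.2 u.2).

Lemma wreath_actM q (u v : wreath_sg) :
  wreath_act q (u ** v) = wreath_act (wreath_act q u) v.
Proof. by rewrite /wreath_act /= ffunE !tactM. Qed.

Definition wreath : tsemigroup := TSemigroup wreath_actM.
End Wreath.

(* KR_wreath n X : X is A_n wr G_n wr ... wr A_1 wr G_1 wr A_0 *)
Inductive KR_wreath : nat -> tsemigroup -> Prop :=
| KR_wreath0 (A : finSemigroupType) :
    aperiodic A -> KR_wreath 0 (regular A)
| KR_wreathS n (X : tsemigroup) (A : finSemigroupType) (G : finGroupType) :
    aperiodic A -> KR_wreath n X ->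
    KR_wreath n.+1 (wreath (regular A) (wreath (regular (group_sg G)) X)).

Definition KR_divides (U : finSemigroupType) (P : {set U}) (n : nat) : Prop :=
  exists2 X, KR_wreath n X & divides P (elements X).

Definition complexity (U : finSemigroupType) (P : {set U}) (n : nat) : Prop :=
  KR_divides P n /\ forall m, KR_divides P m -> (n <= m)%N.

Definition complexity_class (k : nat) (T : finSemigroupType) : Prop :=
  exists2 n, (n <= k)%N & complexity [set: T] n.

Section Pointlike.
Variables (k : nat) (U : finSemigroupType) (M : {set U}).

Definition relational_morphism (T : finSemigroupType) (r : {set U * T}) : Prop :=
  [/\ {in r, forall p, p.1 \in M},
      {in M, forall m, exists t, (m, t) \in r}
    & {in r &, forall p q, (p.1 ** q.1, p.2 ** q.2) \in r}].

Definition pointlike (P : {set U}) : Prop :=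
  P \subset M /\
  forall (T : finSemigroupType) (r : {set U * T}),
    complexity_class k T -> relational_morphism r ->
    exists t : T, {in P, forall m, (m, t) \in r}.

Definition largest_pointlike_subgroup (H K : {set U}) : Prop :=
  [/\ subgroup_set K, K \subset H, pointlike K
    & forall K', subgroup_set K' -> K' \subset H -> pointlike K' ->
        K' \subset K].

End Pointlike.

Definition brel (L : finType) : Type := {set L * L}.
HB.instance Definition _ (L : finType) := Finite.on (brel L).

Section Brel.
Variable L : finType.
Implicit Types f g : brel L.

Definition brel_mul f g : brel L :=
  [set p : L * L | [exists l, ((p.1, l) \in f) && ((l, p.2) \in g)]].

Definition brel_one : brel L := [set p : L * L | p.1 == p.2].

Lemma brel_mulP f g l m :
  reflect (exists2 l', (l, l') \in f & (l', m) \in g) ((l, m) \in brel_mul f g).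
Proof. by rewrite inE; apply: (iffP exists_inP) => -[l' ? ?]; exists l'. Qed.

Lemma brel_mulA : associative brel_mul.
Proof.
move=> f g h; apply/setP => -[l m]; apply/brel_mulP/brel_mulP.
  by case=> x fx /brel_mulP[y gy hm]; exists y => //; apply/brel_mulP; exists x.
by case=> x /brel_mulP[y fy gx] hm; exists y => //; apply/brel_mulP; exists x.
Qed.

Lemma brel_mul1 : left_id brel_one brel_mul.
Proof.
move=> f; apply/setP => -[l m]; apply/brel_mulP/idP => [[x]|lm].
  by rewrite inE /= => /eqP->.
by exists l; rewrite ?inE.
Qed.

Lemma brel_mulr1 : right_id brel_one brel_mul.
Proof.
move=> f; apply/setP => -[l m]; apply/brel_mulP/idP => [[x lx]|lm].
  by rewrite inE /= => /eqP<-.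
by exists m; rewrite ?inE.
Qed.

HB.instance Definition _ :=
  isFinSemigroup.Build (brel L) brel_mulA.

Definition brel_exp f n : brel L := iter n (brel_mul f) brel_one.

(* Dom(f), \overleftarrow{f} and f^\star *)
Definition brel_dom f : {set L} := [set l | [exists m, (l, m) \in f]].
Definition brel_back f : brel L :=
  [set p : L * L | (p.1 == p.2) && (p.1 \in brel_dom f)].
Definition brel_star f : brel L := f :&: [set p : L * L | p.1 == p.2].

End Brel.

Section Flows.
Variables (d : Order.disp_t) (L : finTBLatticeType d).
Implicit Types (f g : brel L) (l m : L).

Local Open Scope order_scope.

Definition closure_ops : {set brel L} :=
  [set f : brel L | ((\top, \top) \in f) &&
     [forall p in f, forall q in f, (p.1 `&` q.1, p.2 `&` q.2) \in f]].

Lemma closure_opsP f :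
  reflect ((\top, \top) \in f /\
           forall l l' m m', (l, m) \in f -> (l', m') \in f ->
             (l `&` l', m `&` m') \in f)
          (f \in closure_ops).
Proof.
rewrite inE; apply: (iffP andP) => -[fT fI]; split=> //.
  by move=> l l' m m' lm lm'; have /forall_inP/(_ _ lm') := forall_inP fI _ lm.
apply/forall_inP => -[l m] lm; apply/forall_inP => -[l' m'] lm' /=.
exact: fI.
Qed.

Variables (flows : {set brel L}) (base : L).

(* The closure conditions defining F_k(L); f^omega is f^n for any n > 0 such
   that f^n is idempotent. *)
Definition flow_closed (k : nat) (M : {set brel L}) : Prop :=
  [/\ M \subset closure_ops,
      brel_one L \in M /\ flows \subset M,
      smul_closed M,
      {in M, forall f, brel_back f \in M}
    & {in M, forall f,
        (exists H K, [/\ maximal_subgroup M H,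
           largest_pointlike_subgroup k M H K & f \in K]) ->
        forall n, (0 < n)%N ->
          brel_exp f n ** brel_exp f n = brel_exp f n ->
          brel_exp f n ** brel_star f \in M}].

Definition flow_monoid (k : nat) : {set brel L} :=
  \bigcap_(M : {set brel L} | `[< flow_closed k M >]) M.

Lemma closure_ops1 : brel_one L \in closure_ops.
Proof.
apply/closure_opsP; split=> [|l l' m m']; rewrite !inE //=.
by move=> /eqP-> /eqP->.
Qed.

Lemma closure_opsM : smul_closed closure_ops.
Proof.
move=> f g /closure_opsP[fT fI] /closure_opsP[gT gI]; apply/closure_opsP.
split=> [|l l' m m' /brel_mulP[x lx xm] /brel_mulP[x' lx' xm']].
  by apply/brel_mulP; exists \top.
by apply/brel_mulP; exists (x `&` x'); [apply: fI | apply: gI].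
Qed.

Lemma closure_ops_back : {in closure_ops, forall f, brel_back f \in closure_ops}.
Proof.
move=> f /closure_opsP[fT fI]; apply/closure_opsP; split=> [|l l' m m'].
  by rewrite !inE eqxx; apply/existsP; exists \top.
rewrite !inE /= => /andP[/eqP-> /existsP[x mx]] /andP[/eqP-> /existsP[x' mx']].
by rewrite eqxx; apply/existsP; exists (x `&` x'); apply: fI.
Qed.

Lemma closure_ops_star : {in closure_ops, forall f, brel_star f \in closure_ops}.
Proof.
move=> f /closure_opsP[fT fI]; apply/closure_opsP; split=> [|l l' m m'].
  by rewrite !inE fT /=.
rewrite !inE /= => /andP[lm /eqP e] /andP[lm' /eqP e'].
by rewrite fI // e e' /=.
Qed.

Lemma closure_ops_flow_closed k :
  flows \subset closure_ops -> flow_closed k closure_ops.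
Proof.
move=> sflow; split=> //; first by split=> //; apply: closure_ops1.
- exact: closure_opsM.
- exact: closure_ops_back.
move=> f fC _ n _ _; apply: closure_opsM; last exact: closure_ops_star.
by elim: n => [|n IHn]; [apply: closure_ops1 | apply: closure_opsM].
Qed.

Definition vacuum (k : nat) : brel L :=
  \bigcap_(f in flow_monoid k) brel_back f.

Definition vacuum_flows (k : nat) : {set brel L} :=
  [set vacuum k ** f ** vacuum k | f in flow_monoid k].

Definition vacuum_dom (k : nat) : {set L} :=
  \bigcap_(f in flow_monoid k) brel_dom f.

(* min {m | (l, m) \in f} for f a closure operator with l in its domain, see
   flow_act_min. *)
Definition flow_act l f : L := \meet_(m : L | (l, m) \in f) m.

Lemma flow_act_min l f : f \in closure_ops -> l \in brel_dom f ->
  (l, flow_act l f) \in f /\ forall m, (l, m) \in f -> flow_act l f <= m.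
Proof.
move=> /closure_opsP[fT fI]; rewrite inE => /existsP[m0 lm0].
have le_act m : (l, m) \in f -> flow_act l f <= m.
  by move=> lm; apply: (meets_inf (P := [pred m | (l, m) \in f]) id lm).
split=> //; rewrite -(meet_idPl (le_act _ lm0)) /flow_act.
elim/big_ind: _ => [|x y lx ly|m lm].
- by rewrite meet1x.
- by rewrite -[l]meetxx -[m0]meetxx meetACA; apply: fI.
- by rewrite -[l]meetxx; apply: fI.
Qed.

(* The least element of LV above base, see start_state_min. *)
Definition start_state (k : nat) : L :=
  \meet_(l in vacuum_dom k | base <= l) l.

Lemma start_state_min k : flows \subset closure_ops ->
  [/\ start_state k \in vacuum_dom k, base <= start_state k
    & forall l, l \in vacuum_dom k -> base <= l -> start_state k <= l].
Proof.
move=> sflow; split; last first.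
- move=> l lV bl; apply: (meets_inf (P := [pred l | l \in vacuum_dom k & base <= l]) id).
  by rewrite /= lV.
- by apply/meetsP => l /andP[].
have fC f : f \in flow_monoid k -> f \in closure_ops.
  by move/bigcapP; apply; apply/asboolP/closure_ops_flow_closed.
rewrite /start_state; elim/big_ind: _ => [|x y /bigcapP xV /bigcapP yV|l /andP[]//].
  apply/bigcapP => f /fC/closure_opsP[fT _]; rewrite inE.
  by apply/existsP; exists \top.
apply/bigcapP => f fF; have /closure_opsP[_ fI] := fC f fF.
have := xV f fF; have := yV f fF; rewrite !inE.
move=> /existsP[m ym] /existsP[m' xm]; apply/existsP; exists (m' `&` m).
exact: fI.
Qed.

(* the set of states of Eval_k(L) *)
Definition eval_states (k : nat) : {set L} :=
  [set flow_act (start_state k) f | f in vacuum_flows k].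

End Flows.

Definition SP (T : finType) : Type :=
  {p : {set T} * {set {set T}} | partition p.2 p.1}.
HB.instance Definition _ (T : finType) := Finite.on (SP T).

Fact sp_display : Order.disp_t. Proof. exact: (Order.Disp tt tt). Qed.

Section SetPartitions.
Variable T : finType.
Implicit Types (p q r : SP T) (x y z : T) (A P Q : {set T}).

Definition sp_supp p : {set T} := (val p).1.
Definition sp_part p : {set {set T}} := (val p).2.

Definition sp_rel p : rel T :=
  [rel x y | [exists P in sp_part p, (x \in P) && (y \in P)]].

Definition sp_le p q : bool :=
  (sp_supp p \subset sp_supp q) &&
  [forall P in sp_part p, exists Q in sp_part q, P \subset Q].

Lemma sp_relP p x y :
  reflect (exists P, [/\ P \in sp_part p, x \in P & y \in P]) (sp_rel p x y).
Proof.
apply: (iffP exists_inP) => [[P pP /andP[xP yP]]|[P [pP xP yP]]]; exists P => //.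
by rewrite xP.
Qed.

Lemma sp_part_uniq p P Q x :
  P \in sp_part p -> Q \in sp_part p -> x \in P -> x \in Q -> P = Q.
Proof.
have /and3P[_ /trivIsetP tI _] := valP p => pP qQ xP xQ.
apply: contraTeq xQ => /(tI _ _ pP qQ)/disjoint_setI0/setP/(_ x).
by rewrite !inE xP /= => ->.
Qed.

Lemma sp_part_neq0 p P : P \in sp_part p -> exists x, x \in P.
Proof.
have /and3P[_ _ n0] := valP p => pP; apply/set0Pn; apply: contraNneq n0 => <-.
exact: pP.
Qed.

Lemma sp_suppE p x : (x \in sp_supp p) = sp_rel p x x.
Proof.
have /and3P[/eqP cov _ _] := valP p.
rewrite -[sp_supp p]cov; apply/bigcupP/sp_relP => [[P pP xP]|].
  by exists P.
by case=> P [pP xP _]; exists P.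
Qed.

Lemma sp_leP p q :
  reflect (forall x y, sp_rel p x y -> sp_rel q x y) (sp_le p q).
Proof.
apply: (iffP andP) => [[_ /forall_inP le_pq] x y|le_pq].
  case/sp_relP=> P [/le_pq/exists_inP[Q qQ /subsetP PQ] /PQ xQ /PQ yQ].
  by apply/sp_relP; exists Q.
split; first by apply/subsetP => x; rewrite !sp_suppE; apply: le_pq.
apply/forall_inP => P pP; have [x xP] := sp_part_neq0 pP.
have /le_pq/sp_relP[Q [qQ xQ _]] : sp_rel p x x by apply/sp_relP; exists P.
apply/exists_inP; exists Q => //; apply/subsetP => y yP.
have /le_pq/sp_relP[Q' [qQ' xQ' yQ']] : sp_rel p x y by apply/sp_relP; exists P.
by rewrite (sp_part_uniq qQ qQ' xQ xQ').
Qed.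

Lemma sp_le_refl : reflexive sp_le.
Proof. by move=> p; apply/sp_leP. Qed.

Lemma sp_le_trans : transitive sp_le.
Proof.
by move=> q p r /sp_leP pq /sp_leP qr; apply/sp_leP => x y /pq; apply: qr.
Qed.

Lemma sp_le_anti : antisymmetric sp_le.
Proof.
move=> p q /andP[le_pq le_qp].
have sub r r' : sp_le r r' -> sp_le r' r -> sp_part r \subset sp_part r'.
  move=> /andP[_ /forall_inP le] /andP[_ /forall_inP le'].
  apply/subsetP => P rP; have [x xP] := sp_part_neq0 rP.
  have /exists_inP[Q rQ sPQ] := le _ rP.
  have /exists_inP[P' rP' sQP'] := le' _ rQ.
  have xQ := subsetP sPQ _ xP.
  have eP := sp_part_uniq rP rP' xP (subsetP sQP' _ xQ).
  by have -> : P = Q by apply/eqP; rewrite eqEsubset sPQ eP.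
have eS : sp_supp p = sp_supp q.
  apply/eqP; rewrite eqEsubset.
  by case/andP: le_pq => -> _; case/andP: le_qp => ->.
have eP : sp_part p = sp_part q by apply/eqP; rewrite eqEsubset !sub.
apply: val_inj; rewrite [val p]surjective_pairing [val q]surjective_pairing.
exact: (congr2 pair eS eP).
Qed.

HB.instance Definition _ :=
  Order.Le_isPOrder.Build sp_display (SP T) sp_le_refl sp_le_anti sp_le_trans.

Definition sp_meet_part (A B : {set {set T}}) : {set {set T}} :=
  [set P :&: Q | P in A, Q in B] :\ set0.

Lemma sp_meet_subproof p q :
  partition (sp_meet_part (sp_part p) (sp_part q)) (sp_supp p :&: sp_supp q).
Proof.
apply/and3P; split; last by rewrite !inE eqxx.
  apply/eqP/setP => x; rewrite inE !sp_suppE; apply/bigcupP/andP.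
    case=> R; rewrite !inE => /andP[_ /imset2P[P Q pP qQ ->]].
    by rewrite inE => /andP[xP xQ]; split; apply/sp_relP; [exists P|exists Q].
  case=> /sp_relP[P [pP xP _]] /sp_relP[Q [qQ xQ _]].
  have xPQ : x \in P :&: Q by rewrite inE xP.
  exists (P :&: Q) => //; rewrite !inE imset2_f // andbT.
  by apply/set0Pn; exists x.
apply/trivIsetP => R R'; rewrite !inE.
move=> /andP[_ /imset2P[P Q pP qQ ->]] /andP[_ /imset2P[P' Q' pP' qQ' ->]].
apply: contraR => /pred0Pn[x]; rewrite /= !inE.
case/andP=> /andP[xP xQ] /andP[xP' xQ'].
by rewrite (sp_part_uniq pP pP' xP xP') (sp_part_uniq qQ qQ' xQ xQ').
Qed.

Definition sp_meet p q : SP T := exist _ (_, _) (sp_meet_subproof p q).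

Lemma sp_part_meet p q :
  sp_part (sp_meet p q) = sp_meet_part (sp_part p) (sp_part q).
Proof. by []. Qed.

Lemma sp_rel_meet p q x y : sp_rel (sp_meet p q) x y = sp_rel p x y && sp_rel q x y.
Proof.
apply/sp_relP/andP => [[R []]|].
  rewrite sp_part_meet !inE => /andP[_ /imset2P[P Q pP qQ ->]].
  rewrite !inE => /andP[xP xQ] /andP[yP yQ].
  by split; apply/sp_relP; [exists P|exists Q].
case=> /sp_relP[P [pP xP yP]] /sp_relP[Q [qQ xQ yQ]].
have xPQ : x \in P :&: Q by rewrite inE xP.
exists (P :&: Q); split; last by rewrite inE yP.
  by rewrite sp_part_meet !inE imset2_f // andbT; apply/set0Pn; exists x.
exact: xPQ.
Qed.

Lemma sp_lexI p q r : (p <= sp_meet q r)%O = (p <= q)%O && (p <= r)%O.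
Proof.
apply/sp_leP/andP => [le|[/sp_leP pq /sp_leP pr] x y pxy].
  by split; apply/sp_leP => x y /le; rewrite sp_rel_meet => /andP[].
by rewrite sp_rel_meet pq // pr.
Qed.

HB.instance Definition _ :=
  Order.POrder_isMeetSemilattice.Build sp_display (SP T) sp_lexI.

Lemma sp_top_subproof : partition ([set [set: T]] :\ set0) [set: T].
Proof.
apply/and3P; split; last by rewrite !inE eqxx.
  apply/eqP/setP => x; rewrite inE; apply/bigcupP; exists [set: T] => //.
  by rewrite !inE eqxx andbT; apply/set0Pn; exists x.
by apply/trivIsetP => A B; rewrite !inE => /andP[_ /eqP->] /andP[_ /eqP->] /eqP.
Qed.

Definition sp_top : SP T := exist _ (_, _) sp_top_subproof.

Lemma sp_lex1 p : (p <= sp_top)%O.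
Proof.
apply/sp_leP => x y _; apply/sp_relP; exists [set: T]; split; rewrite ?in_setT //.
by rewrite in_setD1 in_set1 eqxx andbT; apply/set0Pn; exists x.
Qed.

Lemma sp_bot_subproof : partition (@set0 {set T}) (@set0 T).
Proof. by rewrite partition_set0. Qed.

Definition sp_bot : SP T := exist _ (_, _) sp_bot_subproof.

Lemma sp_le0x p : (sp_bot <= p)%O.
Proof.
by apply/sp_leP => x y /sp_relP[P []]; rewrite inE.
Qed.

HB.instance Definition _ := Order.hasTop.Build sp_display (SP T) sp_lex1.
HB.instance Definition _ := Order.hasBottom.Build sp_display (SP T) sp_le0x.

Definition sp_join p q : SP T := (\meet_(r : SP T | (p <= r) && (q <= r)) r)%O.

Lemma sp_leUx p q r : (sp_join p q <= r)%O = (p <= r)%O && (q <= r)%O.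
Proof.
apply/idP/idP => [le|]; last first.
  exact: (meets_inf (P := [pred r | (p <= r)%O && (q <= r)%O]) id).
by apply/andP; split; apply: le_trans le; apply/meetsP => s /andP[].
Qed.

HB.instance Definition _ :=
  Order.POrder_isJoinSemilattice.Build sp_display (SP T) sp_leUx.

Lemma sp_discrete_subproof A : partition [set [set x] | x in A] A.
Proof.
apply/and3P; split.
- apply/eqP/setP => x; apply/bigcupP/idP => [[P /imsetP[y yA ->]]|xA].
    by rewrite inE => /eqP->.
  by exists [set x]; [apply: imset_f | rewrite inE].
- apply/trivIsetP => P Q /imsetP[x _ ->] /imsetP[y _ ->].
  by apply: contraR => /pred0Pn[z]; rewrite /= !inE => /andP[/eqP-> /eqP->].
- by apply/imsetP => -[x _ /setP/(_ x)]; rewrite !inE eqxx.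
Qed.

Definition sp_discrete A : SP T := exist _ (_, _) (sp_discrete_subproof A).

End SetPartitions.

Definition left_act (G : finGroupType) (B : finType) (g : G) (u : G * B) : G * B :=
  ((g * u.1)%g, u.2).

Definition invariant_sp (G : finGroupType) (B : finType) (p : SP (G * B)%type) : bool :=
  [forall g : G, (left_act g @: sp_supp p == sp_supp p) &&
                 ([set left_act g @: P | P : {set G * B} in sp_part p] == sp_part p)].

Definition cross_section (G : finGroupType) (B : finType) (p : SP (G * B)%type) : bool :=
  [forall P in sp_part p, forall g : G, forall h : G, forall b : B,
     ((g, b) \in P) && ((h, b) \in P) ==> (g == h)].

Definition inv_cross_section (G : finGroupType) (B : finType) : Type :=
  {p : SP (G * B)%type | invariant_sp p && cross_section p}.
HB.instance Definition _ G B := SubFinite.on (inv_cross_section G B).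

(* None is the added top element, the contradiction of Rh_B(G) *)
Definition Rh (G : finGroupType) (B : finType) : Type :=
  option (inv_cross_section G B).
HB.instance Definition _ G B := Finite.on (Rh G B).

Fact rh_display : Order.disp_t. Proof. exact: (Order.Disp tt tt). Qed.

Section Rhodes.
Variables (G : finGroupType) (B : finType).
Implicit Types (p q : SP (G * B)%type) (u v w : Rh G B) (x y : G * B).

Lemma left_actK (g : G) : cancel (@left_act G B g) (left_act g^-1).
Proof. by case=> h b; rewrite /left_act /= mulKg. Qed.

Lemma left_actVK (g : G) : cancel (@left_act G B g^-1) (left_act g).
Proof. by case=> h b; rewrite /left_act /= mulKVg. Qed.

Lemma invariant_spP p :
  reflect (forall g x y, sp_rel p x y -> sp_rel p (left_act g x) (left_act g y))
          (invariant_sp p).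
Proof.
apply: (iffP forallP) => [inv g x y /sp_relP[P [pP xP yP]]|inv g].
  have /andP[_ /eqP eP] := inv g.
  apply/sp_relP; exists (left_act g @: P); split; try exact: imset_f.
  by rewrite -eP; apply: imset_f.
have supp h x : x \in sp_supp p -> left_act h x \in sp_supp p.
  by rewrite !sp_suppE; apply: inv.
have part h P : P \in sp_part p -> left_act h @: P \in sp_part p.
  move=> pP; have [x xP] := sp_part_neq0 pP.
  have /(inv h)/sp_relP[Q [pQ xQ _]] : sp_rel p x x by apply/sp_relP; exists P.
  suff -> : left_act h @: P = Q by [].
  apply/setP => y; apply/imsetP/idP => [[z zP ->]|yQ].
    have /(inv h)/sp_relP[Q' [pQ' xQ' zQ']] : sp_rel p x z.
      by apply/sp_relP; exists P.
    by rewrite (sp_part_uniq pQ pQ' xQ xQ').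
  have /(inv h^-1%g) : sp_rel p (left_act h x) y by apply/sp_relP; exists Q.
  rewrite left_actK => /sp_relP[P' [pP' xP' yP']].
  exists (left_act h^-1%g y); last by rewrite left_actVK.
  by rewrite (sp_part_uniq pP pP' xP xP').
apply/andP; split; rewrite eqEsubset; apply/andP; split.
- by apply/subsetP => _ /imsetP[x xp ->]; apply: supp.
- apply/subsetP => x xp; apply/imsetP; exists (left_act g^-1%g x).
    exact: supp.
  by rewrite left_actVK.
- by apply/subsetP => _ /imsetP[P pP ->]; apply: part.
- apply/subsetP => P pP; apply/imsetP; exists (left_act g^-1%g @: P).
    exact: part.
  by rewrite -imset_comp (eq_imset _ (left_actVK g)) imset_id.
Qed.

Lemma cross_sectionP p :
  reflect (forall g h b, sp_rel p (g, b) (h, b) -> g = h) (cross_section p).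
Proof.
apply: (iffP forall_inP) => [cs g h b /sp_relP[P [pP gP hP]]|cs P pP].
  apply/eqP; have /forallP/(_ g)/forallP/(_ h)/forallP/(_ b) := cs P pP.
  by rewrite gP hP.
apply/forallP => g; apply/forallP => h; apply/forallP => b; apply/implyP.
by case/andP => gP hP; apply/eqP/(cs _ _ b)/sp_relP; exists P.
Qed.

Definition rh_le u v : bool :=
  match u, v with
  | _, None => true
  | None, Some _ => false
  | Some p, Some q => (val p <= val q)%O
  end.

Lemma rh_le_refl : reflexive rh_le.
Proof. by case=> //= p. Qed.

Lemma rh_le_anti : antisymmetric rh_le.
Proof. by move=> [p|] [q|] //= /le_anti/val_inj->. Qed.

Lemma rh_le_trans : transitive rh_le.
Proof. by move=> [q|] [p|] [r|] //=; apply: le_trans. Qed.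

HB.instance Definition _ :=
  Order.Le_isPOrder.Build rh_display (Rh G B) rh_le_refl rh_le_anti rh_le_trans.

Lemma rh_meet_subproof (p q : inv_cross_section G B) :
  invariant_sp (val p `&` val q)%O && cross_section (val p `&` val q)%O.
Proof.
case: p q => [p /= /andP[/invariant_spP ip /cross_sectionP cp]].
case=> [q /= /andP[/invariant_spP iq _]]; apply/andP; split.
  apply/invariant_spP => g x y; rewrite !sp_rel_meet => /andP[pxy qxy].
  by rewrite ip ?iq.
by apply/cross_sectionP => g h b; rewrite sp_rel_meet => /andP[/cp].
Qed.

Definition rh_meet u v : Rh G B :=
  match u, v with
  | Some p, Some q => Some (Sub (val p `&` val q)%O (rh_meet_subproof p q))
  | Some p, None => Some p
  | None, v => v
  end.

Lemma rh_lexI u v w : (u <= rh_meet v w)%O = (u <= v)%O && (u <= w)%O.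
Proof.
case: u v w => [p|] [q|] [r|]; rewrite ?andbT ?andbF //.
exact: (lexI (val p) (val q) (val r)).
Qed.

HB.instance Definition _ :=
  Order.POrder_isMeetSemilattice.Build rh_display (Rh G B) rh_lexI.

Lemma rh_lex1 u : (u <= (None : Rh G B))%O.
Proof. by case: u. Qed.

Lemma rh_bot_subproof :
  invariant_sp (sp_bot (G * B)%type) && cross_section (sp_bot (G * B)%type).
Proof.
have bot x y : sp_rel (sp_bot (G * B)%type) x y = false.
  by apply/sp_relP => -[P []]; rewrite inE.
apply/andP; split; first by apply/invariant_spP => g x y; rewrite bot.
by apply/cross_sectionP => g h b; rewrite bot.
Qed.

Definition rh_bot : Rh G B := Some (Sub (sp_bot _) rh_bot_subproof).

Lemma rh_le0x u : (rh_bot <= u)%O.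
Proof. by case: u => [p|//]; apply: (le0x (val p)). Qed.

HB.instance Definition _ := Order.hasTop.Build rh_display (Rh G B) rh_lex1.
HB.instance Definition _ := Order.hasBottom.Build rh_display (Rh G B) rh_le0x.

Definition rh_join u v : Rh G B :=
  (\meet_(w : Rh G B | (u <= w) && (v <= w)) w)%O.

Lemma rh_leUx u v w : (rh_join u v <= w)%O = (u <= w)%O && (v <= w)%O.
Proof.
apply/idP/idP => [le|]; last first.
  exact: (meets_inf (P := [pred w | (u <= w)%O && (v <= w)%O]) id).
by apply/andP; split; apply: le_trans le; apply/meetsP => s /andP[].
Qed.

HB.instance Definition _ :=
  Order.POrder_isJoinSemilattice.Build rh_display (Rh G B) rh_leUx.

Lemma rh_discrete_subproof (b : B) :
  invariant_sp (sp_discrete [set u : G * B | u.2 == b]) &&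
  cross_section (sp_discrete [set u : G * B | u.2 == b]).
Proof.
have rel x y : sp_rel (sp_discrete [set u : G * B | u.2 == b]) x y
               = (x == y) && (x.2 == b).
  apply/sp_relP/andP => [[P [/imsetP[z]]]|[/eqP<- xb]].
    by rewrite inE => zb ->; rewrite !inE => /eqP-> /eqP->.
  by exists [set x]; rewrite !inE; split=> //; apply: imset_f; rewrite inE.
apply/andP; split.
  by apply/invariant_spP => g x y; rewrite !rel => /andP[/eqP<- ?]; rewrite eqxx.
by apply/cross_sectionP => g h b'; rewrite rel => /andP[/eqP[]].
Qed.

Definition rh_start (b : B) : Rh G B := Some (Sub (sp_discrete _) (rh_discrete_subproof b)).

End Rhodes.

Arguments rh_start {G B}.

Section Ideals.
Variable S : finSemigroupType.
Implicit Types I J : {set S}.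

Definition is_zero (z : S) : Prop := forall s, z ** s = z /\ s ** z = z.

Definition ideal I : Prop :=
  I != set0 /\ {in I, forall x s, s ** x \in I /\ x ** s \in I}.

Definition zero_minimal_ideal I : Prop :=
  exists2 z, is_zero z &
    [/\ ideal I, I != [set z]
      & forall J, ideal J -> J \subset I -> J = [set z] \/ J = I].

End Ideals.

Definition ptrans (B : finType) : Type := {ffun B -> option B}.
HB.instance Definition _ (B : finType) := Finite.on (ptrans B).

Definition ptrans_mul (B : finType) (s t : ptrans B) : ptrans B :=
  [ffun b => obind t (s b)].

Lemma ptrans_mulA (B : finType) : associative (@ptrans_mul B).
Proof. by move=> s t u; apply/ffunP => b; rewrite !ffunE; case: (s b) => //= c; rewrite ffunE. Qed.

HB.instance Definition _ (B : finType) :=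
  isFinSemigroup.Build (ptrans B) (@ptrans_mulA B).

Section GroupMapping.
Variables (S : finSemigroupType) (G : finGroupType) (A B : finType).

(* M^0(A, G, B, C) with None as its zero, and as the zero of G^0 in the
   sandwich matrix C. *)
Definition rees (C : B -> A -> option G) (u v : option (A * G * B)) :
    option (A * G * B) :=
  match u, v with
  | Some (a, g, b), Some (a', h, b') =>
      if C b a' is Some c then Some (a, (g * c * h)%g, b') else None
  | _, _ => None
  end.

Definition regular_sandwich (C : B -> A -> option G) : Prop :=
  (forall b, exists a, C b a != None) /\ (forall a, exists b, C b a != None).

(* iota identifies M^0(A, G, B, C) with I(S). *)
Record group_mapping (C : B -> A -> option G) (iota : option (A * G * B) -> S) :
    Prop := GroupMapping {
  gm_inj : injective iota;
  gm_morph : forall u v, iota (rees C u v) = iota u ** iota v;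
  gm_zero_minimal : zero_minimal_ideal [set iota u | u : option (A * G * B)];
  gm_unique : forall J, zero_minimal_ideal J ->
    J = [set iota u | u : option (A * G * B)];
  gm_regular : regular_sandwich C;
  gm_nontrivial : (1 < #|[set: G]|)%N;
  gm_faithful_right : exists a, forall s t,
    (forall g b, iota (Some (a, g, b)) ** s = iota (Some (a, g, b)) ** t) -> s = t;
  gm_faithful_left : exists b, forall s t,
    (forall a g, s ** iota (Some (a, g, b)) = t ** iota (Some (a, g, b))) -> s = t
}.

Variables (iota : option (A * G * B) -> S) (a0 : A).

(* (G x B, S), G x B being the R-class {a0} x G x B of I(S). *)
Definition gm_act (u : G * B) (s : S) : option (G * B) :=
  [pick v : G * B | iota (Some (a0, u.1, u.2)) ** s == iota (Some (a0, v.1, v.2))].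

(* The action on B induced by gm_act; it may be read off at g = 1 since gm_act
   commutes with left_act. *)
Definition rlm (s : S) : ptrans B :=
  [ffun b => omap snd (gm_act (1%g, b) s)].

Definition RLM : {set ptrans B} := [set rlm s | s : S].

Definition free_flow_cond (x : S) (p q : SP (G * B)%type) : bool :=
  [forall y in sp_supp p, forall z : G * B,
     (gm_act y x == Some z) ==> (z \in sp_supp q)] &&
  [forall y in sp_supp p, forall y' in sp_supp p,
   forall z : G * B, forall z' : G * B,
     (gm_act y x == Some z) && (gm_act y' x == Some z') ==>
       (sp_rel p y y' == sp_rel q z z')].

Definition sp_free_flow (x : S) : brel (SP (G * B)%type) :=
  [set pq : SP (G * B)%type * SP (G * B)%type | free_flow_cond x pq.1 pq.2].

Definition rh_free_flow (x : S) : brel (Rh G B) :=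
  [set uv : Rh G B * Rh G B |
     match uv with
     | (Some p, Some q) => free_flow_cond x (val p) (val q)
     | (None, None) => true
     | _ => false
     end].

Lemma sp_free_flow_closure x : sp_free_flow x \in closure_ops (SP (G * B)%type).
Proof.
apply/closure_opsP; split=> [|p p' q q'].
  have top y z : sp_rel (\top : SP (G * B)%type)%O y z.
    apply/sp_relP; exists [set: G * B]; split; rewrite ?in_setT //.
    by rewrite in_setD1 in_set1 eqxx andbT; apply/set0Pn; exists y.
  rewrite inE; apply/andP; split.
    apply/forall_inP => y _; apply/forallP => z; apply/implyP => _.
    by rewrite sp_suppE top.
  apply/forall_inP => y _; apply/forall_inP => y' _.
  by apply/forallP => z; apply/forallP => z'; rewrite !top eqxx implybT.
rewrite !inE /= => /andP[/forall_inP s1 /forall_inP c1].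
move=> /andP[/forall_inP s2 /forall_inP c2]; apply/andP; split.
  apply/forall_inP => y; rewrite inE => /andP[yp yp'].
  apply/forallP => z; apply/implyP => yz; rewrite inE.
  by rewrite (implyP (forallP (s1 _ yp) z) yz) (implyP (forallP (s2 _ yp') z) yz).
apply/forall_inP => y; rewrite inE => /andP[yp yp'].
apply/forall_inP => w; rewrite inE => /andP[wp wp'].
apply/forallP => z; apply/forallP => z'; apply/implyP => yz.
have := implyP (forallP (forallP (forall_inP (c1 _ yp) _ wp) z) z') yz.
have := implyP (forallP (forallP (forall_inP (c2 _ yp') _ wp') z) z') yz.
by rewrite !sp_rel_meet => /eqP-> /eqP->.
Qed.

Lemma rh_free_flow_closure x : rh_free_flow x \in closure_ops (Rh G B).
Proof.
apply/closure_opsP; split=> [|u u' v v']; first by rewrite inE.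
case: u u' v v' => [p|] [p'|] [q|] [q'|]; rewrite !inE //= => pq pq'.
have /closure_opsP[_ fI] := sp_free_flow_closure x.
have := fI (val p) (val p') (val q) (val q'); rewrite !inE; exact.
Qed.

Variables (X : {set S}) (b0 : B).

Definition sp_states (k : nat) : {set SP (G * B)%type} :=
  eval_states [set sp_free_flow x | x in X] (sp_discrete [set (1%g, b0)]) k.

Definition rh_states (k : nat) : {set Rh G B} :=
  eval_states [set rh_free_flow x | x in X] (rh_start b0) k.

End GroupMapping.

Definition sp_contradiction (G : finGroupType) (B : finType)
    (p : SP (G * B)%type) : Prop := ~~ cross_section p.

Definition rh_contradiction (G : finGroupType) (B : finType) (u : Rh G B) : Prop :=
  u = None.

(* Main.v *)
Require Import Defs.
From mathcomp Require Import all_boot all_order all_fingroup.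
From HB Require Import structures.
From mathcomp Require Import boolp zify.

(** The upper bound is the classical inequality Sc <= RLM(S)c + 1.  The
    semigroup S acts on G x B through its action [rlm] on B and a G-valued
    multiplier at each point of B, so S should embed in a wreath product of G
    over RLM(S).  As RLM(S) only divides the semigroup T of an iterated wreath
    product, the point of B that has been reached cannot be read off a state.
    [KR_covering] replaces the wreath product by one of the same length whose
    states store the value in T^I of the word read so far; the group G^B can
    then be put on top of it ([KR_divides_RLM]).

    For the lower bound, S is not aperiodic as G is non-trivial; so suppose
    that S divides A wr H wr X, where A is
    aperiodic, H is a group and X is an iterated wreath product of length
    n < k with semigroup T.  Projecting A away leaves a relation from S to the
    semidirect product of a group with M = T^I, and by aperiodicity of A the
    elements of S that are related to an idempotent have stable powers.

    This relation gives a flow, a map F from M to the invariant cross-sections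
    of G x B such that for each s in S some w in M satisfies
    (F(u), F(uw)) in f_s for all u ([aperiodic_flow]).  To obtain F, take an
    idempotent (e, f) of the relation with e in the R-class G x B that generates
    a minimal right ideal, and look at the pairs (y, r) of its R-class, y being
    a point of G x B and r a pair of a group coordinate and a monoid coordinate.
    F(u) consists of the points y that occur with a monoid coordinate L-equivalent
    to u, and y, y' are in the same class if they occur with a common r.  Two
    points (g, b), (h, b) with a common r give an element of the relation that
    relates the translate of e by h g^-1 to the idempotent f, whence g = h: this is
    the cross-section property ([reach_cross_section]).  Transitivity
    ([reach_exchange]) and the equivalence in the definition of the free flow
    ([reach_cancel]) come from cancellation in the group coordinate.

    Say that t in M carries a closure operator f if (F(u), F(ut)) is in f for
    all u.  The operators that are carried contain the free flows and are closed
    under the operations that generate the flow monoid.  For omega + star this is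
    where pointlikes come in: carrying is a relational morphism to M, which has
    complexity at most k - 1, so a pointlike group is carried by a single
    idempotent ([flow_monoid_carried]).  Consequently every state of the
    evaluation transformation semigroup lies below some F(u)
    ([eval_states_bound]), so none is a contradiction.  The same F serves for
    both lattices. *)

Set Implicit Arguments.
Unset Strict Implicit.
Unset Printing Implicit Defensive.

Local Open Scope semigroup_scope.

(** * Powers and aperiodicity *)

Section Powers.
Variable S : finSemigroupType.
Implicit Types (s t : S) (m n : nat).

(** The exponent is shifted, [spow s n] being the power s^(n+1), because a
    semigroup need not contain s^0. *)
Definition spow s n : S := iter n (fun t => t ** s) s.

Lemma spowS s n : spow s n.+1 = spow s n ** s.
Proof. by []. Qed.

Lemma spowD s m n : spow s m ** spow s n = spow s (m + n).+1.
Proof.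
by elim: n => [|n IHn]; rewrite ?addn0 // addnS !spowS smulA IHn.
Qed.

Lemma spowSl s n : spow s n.+1 = s ** spow s n.
Proof. exact: esym (spowD s 0 n). Qed.

Lemma spow_period s i d n : spow s (i + d) = spow s i -> (i <= n)%N ->
  spow s (n + d) = spow s n.
Proof.
move=> per /subnK <-; elim: (n - i)%N => // j IHj.
by rewrite !addSn !spowS IHj.
Qed.

Lemma idempotent_spow s : exists n, spow s n ** spow s n = spow s n.
Proof.
have [i [d [d0 per]]] : exists i d, (0 < d)%N /\ spow s (i + d) = spow s i.
  have [/injectiveP inj | /injectivePn[x [y nxy exy]]] :=
    boolP (injectiveb (fun x : 'I_#|S|.+1 => spow s x)).
    by have := leq_card _ inj; rewrite card_ord ltnn.
  wlog lt_xy : x y nxy exy / (x < y)%N.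
    move=> th; have [lt_xy|le_yx] := ltnP x y; first exact: (th x y).
    by apply: (th y x); rewrite 1?eq_sym // ltn_neqAle le_yx eq_sym nxy.
  exists x, (y - x)%N; rewrite subn_gt0 lt_xy; split => //.
  by rewrite subnKC // ltnW.
(* s^m is idempotent once m exceeds the index i and is a multiple of d *)
have mul q n : (i <= n)%N -> spow s (n + q * d) = spow s n.
  move=> le_in; elim: q => [|q IHq]; first by rewrite addn0.
  by rewrite mulSn addnCA addnC (spow_period per) // (leq_trans le_in) ?leq_addr.
exists (i.+1 * d).-1; rewrite spowD.
have d_gt : (0 < i.+1 * d)%N by rewrite muln_gt0.
rewrite -addnS prednK // mul //.
by rewrite -ltnS prednK // -[X in (X <= _)%N]muln1 leq_mul.
Qed.

Definition stable_power s : Prop := exists n, spow s n.+1 = spow s n.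

Lemma stable_spow_le s m n : spow s m.+1 = spow s m -> (m <= n)%N ->
  spow s n.+1 = spow s n.
Proof. by rewrite -addn1 -[n.+1]addn1; apply: spow_period. Qed.

Lemma stable_powerP : aperiodic S <-> forall s, stable_power s.
Proof.
split=> [ap s | st H [closedH [e eH groupH]]]; last first.
  apply/eqP/cards1P; exists e; apply/setP => x; rewrite inE.
  apply/idP/eqP => [xH | -> //].
  have [ex _ [y yH [xy _]]] := groupH x xH; have [n] := st x.
  have pH : spow x n \in H by elim: n => // n IHn; rewrite spowS closedH.
  have [_ pe [z zH [_ zp]]] := groupH _ pH.
  by rewrite spowS => /(congr1 (smul z)); rewrite smulA zp ex.
have [n en] := idempotent_spow s.
have per m : (n <= m)%N -> spow s (m + n.+1) = spow s m.
  by apply: spow_period; rewrite addnS -spowD.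
have unit m : (n <= m)%N -> spow s m ** spow s n = spow s m.
  by move=> le_nm; rewrite spowD -addnS per.
have unitl m : (n <= m)%N -> spow s n ** spow s m = spow s m.
  by move=> le_nm; rewrite spowD addnC -addnS per.
pose H := [set x : S | `[< exists2 m, (n <= m)%N & x = spow s m >]].
have inH m : (n <= m)%N -> spow s m \in H.
  by move=> le_nm; rewrite inE; apply/asboolP; exists m.
have /eqP/cards1P[x Hx] : #|H| = 1%N.
  apply: ap; split=> [x y|].
    rewrite !inE => /asboolP[i ni ->] /asboolP[j nj ->].
    by rewrite spowD; apply/asboolP; exists (i + j).+1 => //; lia.
  exists (spow s n); first exact: inH.
  move=> x; rewrite inE => /asboolP[m le_nm ->].
  split; [exact: unitl | exact: unit |].
  exists (spow s (m.+2 * n)); first by apply: inH; lia.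
  have mul q : spow s (n + q * n.+1) = spow s n.
    elim: q => [|q IHq]; first by rewrite addn0.
    by rewrite mulSn addnCA addnC per ?leq_addr.
  rewrite !spowD.
  have -> : (m + m.+2 * n).+1 = (n + m.+1 * n.+1)%N by lia.
  by have -> : (m.+2 * n + m).+1 = (n + m.+1 * n.+1)%N by lia.
exists n.
have: spow s n \in H by exact: inH.
have: spow s n.+1 \in H by exact: inH.
by rewrite Hx !inE => /eqP-> /eqP->.
Qed.
End Powers.

Arguments spow {S} s n : simpl never.

(** * Adjoined identities and function semigroups *)

(** The semigroup T^I, with None as the new identity. *)
Definition adj1 (T : finSemigroupType) : Type := option T.
HB.instance Definition _ T := Finite.on (adj1 T).

Section Adj1.
Variable T : finSemigroupType.

Definition adj1_mul (u v : adj1 T) : adj1 T :=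
  match u, v with
  | Some s, Some t => Some (s ** t)
  | None, _ => v
  | _, None => u
  end.

Lemma adj1_mulA : associative adj1_mul.
Proof. by case=> [s|] [t|] [u|] //=; rewrite smulA. Qed.

HB.instance Definition _ := isFinSemigroup.Build (adj1 T) adj1_mulA.

Lemma adj1_mul1 (u : adj1 T) : (None : adj1 T) ** u = u.
Proof. by case: u. Qed.

Lemma adj1_mulr1 (u : adj1 T) : u ** (None : adj1 T) = u.
Proof. by case: u. Qed.

Lemma adj1_spow (s : T) n : spow (Some s : adj1 T) n = Some (spow s n).
Proof. by elim: n => // n IHn; rewrite !spowS IHn. Qed.

Lemma adj1_aperiodic : aperiodic T -> aperiodic (adj1 T).
Proof.
move/stable_powerP=> st; apply/stable_powerP => -[s|]; last by exists 0.
by have [n eq_n] := st s; exists n; rewrite !adj1_spow eq_n.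
Qed.
End Adj1.

Definition pow_sg (Q : finType) (T : finSemigroupType) : Type := {ffun Q -> T}.
HB.instance Definition _ Q T := Finite.on (pow_sg Q T).

Section PowSg.
Variables (Q : finType) (T : finSemigroupType).

Definition pow_mul (f g : pow_sg Q T) : pow_sg Q T := [ffun q => f q ** g q].

Lemma pow_mulA : associative pow_mul.
Proof. by move=> f g h; apply/ffunP => q; rewrite !ffunE smulA. Qed.

HB.instance Definition _ := isFinSemigroup.Build (pow_sg Q T) pow_mulA.

Lemma pow_spow (f : pow_sg Q T) n q : spow f n q = spow (f q) n.
Proof. by elim: n => // n IHn; rewrite !spowS ffunE IHn. Qed.

Lemma aperiodic_uniform (F : Q -> T) : aperiodic T ->
  exists n, forall q, spow (F q) n.+1 = spow (F q) n.
Proof.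
move=> /stable_powerP st; have /choice[nu nuP] q : stable_power (F q) by [].
exists (\max_q nu q) => q; apply: stable_spow_le (nuP q) _.
exact: (leq_bigmax q).
Qed.

Lemma pow_aperiodic : aperiodic T -> aperiodic (pow_sg Q T).
Proof.
move=> ap; apply/stable_powerP => f.
have [n eq_n] := aperiodic_uniform f ap.
by exists n; apply/ffunP => q; rewrite !pow_spow eq_n.
Qed.
End PowSg.

(** The first component of the n-th power of (a, r) is
    p |-> a(p) a(pr)^n, because r is idempotent. *)
Lemma wreath_stable_power (A : finSemigroupType) (Y : tsemigroup)
    (w : elements (wreath (regular A) Y)) :
  aperiodic A -> w.2 ** w.2 = w.2 -> stable_power w.
Proof.
case: w => a r /= ap rr.
have wE n : spow ((a, r) : elements (wreath (regular A) Y)) n.+1 =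
    ([ffun p => a p ** spow (a (tact p r)) n], r).
  elim: n => [|n IHn]; rewrite spowS; first by congr (_, _).
  rewrite IHn; congr (_, _) => //=.
  by apply/ffunP => p; rewrite !ffunE spowS smulA.
have [n eq_n] := aperiodic_uniform (fun p => a (tact p r)) ap.
exists n.+1; rewrite !wE; congr (_, _).
by apply/ffunP => p; rewrite !ffunE eq_n.
Qed.

(** * Coverings *)

(** The divisions below are described by what an element w represents, and
    only relations [R w u] are natural for this; u0 is a junk value. *)
Lemma divides_rel (U T : finSemigroupType) (P : {set U}) (R : T -> U -> Prop) (u0 : U) :
    (forall w u v, R w u -> R w v -> u = v) ->
    (forall w u w' u', R w u -> R w' u' -> R (w ** w') (u ** u')) ->
    (forall w u, R w u -> u \in P) ->
    (forall u, u \in P -> exists w, R w u) ->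
  divides P T.
Proof.
move=> fR mR RP onto.
pose h w := if pselect (exists u, R w u) is left e then sval (cid e) else u0.
have hE w u : R w u -> h w = u.
  move=> wu; rewrite /h; case: pselect => [e|]; last by case; exists u.
  by apply: fR wu; apply: svalP (cid e).
exists [set w | `[< exists u, R w u >]], h; split.
- move=> w w'; rewrite !inE => /asboolP[u wu] /asboolP[u' wu'].
  by apply/asboolP; exists (u ** u'); apply: mR.
- move=> w w'; rewrite !inE => /asboolP[u wu] /asboolP[u' wu'].
  by rewrite (hE _ _ wu) (hE _ _ wu') (hE _ _ (mR _ _ _ _ wu wu')).
apply/setP => u; apply/imsetP/idP => [[w]|/onto[w wu]].
  by rewrite inE => /asboolP[v wv ->]; rewrite (hE _ _ wv); apply: RP wv.
by exists w; rewrite ?inE; [apply/asboolP; exists u | rewrite (hE _ _ wu)].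
Qed.

Section AdjoinedAction.
Variable X : tsemigroup.

Definition adj1_act (q : states X) (m : adj1 (elements X)) : states X :=
  if m is Some t then tact q t else q.

Lemma adj1_actM q m m' : adj1_act q (m ** m') = adj1_act (adj1_act q m) m'.
Proof. by case: m m' => [s|] [t|] //=; apply: tactM. Qed.

Definition adj1_ts : tsemigroup := TSemigroup adj1_actM.
End AdjoinedAction.

(** [covering X Y] says that Y computes in T^I, T being the semigroup of X:
    [eta d m] means that the element d of Y acts as right multiplication by m,
    and [zeta q m] that the state q of Y stores m.  In contrast to a division
    of semigroups this keeps track of states, so that the value in T^I of the
    word read so far can be used by what is placed on top of Y. *)
Definition covering (X Y : tsemigroup) : Prop :=
  exists (eta : elements Y -> adj1 (elements X) -> Prop)
         (zeta : states Y -> adj1 (elements X) -> Prop) (q1 : states Y),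
  [/\ (forall d m m', eta d m -> eta d m' -> m = m'),
      (forall q m m', zeta q m -> zeta q m' -> m = m'),
      (forall m, exists d, eta d m),
      zeta q1 None
    & (forall d m, eta d m ->
         (forall d' m', eta d' m' -> eta (d ** d') (m ** m')) /\
         (forall q m', zeta q m' -> zeta (tact q d) (m' ** m)))].

Lemma covering_divides X Y : covering X Y ->
  divides [set: adj1 (elements X)] (elements Y).
Proof.
case=> eta [zeta [q1 [f_eta _ onto _ hom]]].
apply: (@divides_rel _ _ _ eta None) => //.
- by move=> d m d' m' dm; apply: (hom _ _ dm).1.
- by move=> d m _; rewrite in_setT.
Qed.

Lemma covering_regular (A : finSemigroupType) :
  covering (regular A) (regular (adj1 A)).
Proof.
exists (fun d m => d = m), (fun q m => odflt None q = m), None; split.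
- by move=> d m m' <-.
- by move=> q m m' <- <-.
- by move=> m; exists m.
- by [].
move=> d m dm; rewrite -dm; split=> [d' m' <- //|q m' <-].
by case: q => [q|] //=; rewrite adj1_mul1.
Qed.

(** A state of the covering of A wr X must know a function f : Q -> A, Q being
    the states of X.  The new coordinate ranges over a semigroup P that contains
    the functions Q -> A; at a state that stores m, the element (f, t) has to
    multiply it by p |-> f(pm), which is why the covering of X keeps m. *)
Lemma covering_wreath (A P : finSemigroupType) (X Y : tsemigroup)
    (I : pow_sg (states X) A -> P) (oneP : P) :
    injective I -> {morph I : f g / f ** g} ->
    left_id oneP smul -> right_id oneP smul ->
    covering X Y ->
  covering (wreath (regular A) X) (wreath (regular P) Y).
Proof.
move=> injI morI one1 oner1 [eta [zeta [q1 [f_eta f_zeta onto q1P hom]]]].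
pose W := wreath (regular A) X.
pose shift (f : {ffun states X -> A}) m : pow_sg (states X) A :=
  [ffun p => f (adj1_act p m)].
have shift1 f : shift f None = f by apply/ffunP => p; rewrite ffunE.
pose eta' (d : elements (wreath (regular P) Y)) (w : adj1 (elements W)) : Prop :=
  if w is Some (f, t) then
    eta d.2 (Some t) /\ forall q m, zeta q m -> d.1 q = I (shift f m)
  else eta d.2 None /\ forall q, d.1 q = oneP.
pose zeta' (q : states (wreath (regular P) Y)) (w : adj1 (elements W)) : Prop :=
  if w is Some (f, t) then zeta q.2 (Some t) /\ q.1 = Some (I f)
  else zeta q.2 None /\ (if q.1 is Some u then u = oneP else True).
exists eta', zeta', (None, q1); split.
- move=> [F d] [[f t]|] [[f' t']|] //= [dm Fm] [dm' Fm'].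
  + have := Fm q1 None q1P; rewrite (Fm' q1 None q1P) !shift1 => /injI->.
    by have [->] := f_eta _ _ _ dm dm'.
  + by have := f_eta _ _ _ dm dm'.
  + by have := f_eta _ _ _ dm dm'.
- move=> [F q] [[f t]|] [[f' t']|] //= [qm Fm] [qm' Fm'].
  + by move: Fm'; rewrite Fm => -[/injI->]; have [->] := f_zeta _ _ _ qm qm'.
  + by have := f_zeta _ _ _ qm qm'.
  + by have := f_zeta _ _ _ qm qm'.
- case=> [[f t]|].
    have [d dt] := onto (Some t).
    pose F q := if pselect (exists m, zeta q m) is left e
                then I (shift f (sval (cid e))) else oneP.
    exists ([ffun q => F q], d); split=> //= q m qm.
    rewrite ffunE /F; case: pselect => [e|]; last by case; exists m.
    by rewrite (f_zeta _ _ _ (svalP (cid e)) qm).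
  have [d dt] := onto None.
  by exists ([ffun=> oneP], d); split=> //= q; rewrite ffunE.
- by [].
move=> [F d] w Fdw.
have dz q m : zeta q m -> zeta (tact q d) (m ** omap snd w).
  by move: w Fdw => [[f t]|] /= [dm _]; apply: (hom _ _ dm).2.
have de d' m' : eta d' m' -> eta (d ** d') ((omap snd w : adj1 _) ** m').
  by move: w Fdw {dz} => [[f t]|] /= [dm _]; apply: (hom _ _ dm).1.
split=> [[F' d'] [[f' t']|] /= [dm' Fm']|[F' q] [[f' t']|] /= [qm' Fm']].
- move: w Fdw dz de => [[f t]|] /= [dm Fm] dz de; split; try exact: (de _ _ dm').
    move=> q m qm; rewrite ffunE /= (Fm _ _ qm) (Fm' _ _ (dz _ _ qm)) -morI.
    by congr I; apply/ffunP => p; rewrite !ffunE adj1_actM.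
  move=> q m qm; rewrite ffunE /= Fm one1.
  by rewrite -[m in RHS]adj1_mulr1; apply: Fm'; apply: dz.
- move: w Fdw dz de => [[f t]|] /= [dm Fm] dz de; split; try exact: (de _ _ dm').
    by move=> q m qm; rewrite ffunE /= Fm' oner1; apply: Fm.
  by move=> q; rewrite ffunE /= Fm Fm' oner1.
- move: w Fdw dz de => [[f t]|] /= [dm Fm] dz de; split; try exact: (dz _ _ qm').
    rewrite Fm' /= /regular_act (Fm _ _ qm') -morI; congr (Some (I _)).
    by apply/ffunP => p; rewrite !ffunE.
  by rewrite Fm' /= /regular_act Fm oner1.
- move: w Fdw dz de => [[f t]|] /= [dm Fm] dz de; split; try exact: (dz _ _ qm').
    rewrite /= /regular_act (Fm _ _ qm') shift1.
    by case: F' Fm' => //= u ->; rewrite one1.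
  by rewrite /= Fm; case: F' Fm' => //= u ->; rewrite one1.
Qed.

Lemma KR_covering n X : KR_wreath n X -> exists2 Y, KR_wreath n Y & covering X Y.
Proof.
elim=> [A apA|{}n {}X A G apA _ [Y KRY cov]].
  exists (regular (adj1 A)); last exact: covering_regular.
  exact/KR_wreath0/adj1_aperiodic.
pose GX : finGroupType := {dffun forall _ : states X, G}.
pose Z := wreath (regular (group_sg GX)) Y.
have covZ : covering (wreath (regular (group_sg G)) X) Z.
  apply: (@covering_wreath (group_sg G) (group_sg GX) X Y (fun f => f) (1%g : GX)).
  - by [].
  - by [].
  - exact: (@mul1g GX).
  - exact: (@mulg1 GX).
  - exact: cov.
pose W := wreath (regular (group_sg G)) X.
exists (wreath (regular (adj1 (pow_sg (states W) A))) Z).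
  by apply: KR_wreathS => //; apply: adj1_aperiodic; apply: pow_aperiodic.
apply: (@covering_wreath A (adj1 (pow_sg (states W) A)) W Z Some None).
- by move=> f g [].
- by [].
- exact: adj1_mul1.
- exact: adj1_mulr1.
- exact: covZ.
Qed.

(** * Flows bound the evaluation states *)

Section FlowBound.
Variables (disp : Order.disp_t) (L : finTBLatticeType disp).
Variables (flows : {set brel L}) (base : L) (k : nat).
Variables (M : finSemigroupType) (one : M) (F : M -> L).
Hypothesis oner1 : right_id one smul.
Hypothesis class_M : complexity_class k M.
Hypothesis flowsC : flows \subset closure_ops L.

Definition carried (f : brel L) (t : M) : Prop :=
  forall u, (F u, F (u ** t)) \in f.

Hypothesis flows_carried : {in flows, forall f, exists t, carried f t}.

Lemma carriedM f g t t' : carried f t -> carried g t' -> carried (f ** g) (t ** t').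
Proof. by move=> ft gt' u; apply/brel_mulP; exists (F (u ** t)); rewrite ?smulA. Qed.

(** Carrying is a relational morphism to M, and M is one of the semigroups that
    pointlike sets are tested on.  So all members of a pointlike group are
    carried by one element t, hence also by an idempotent power of t; f^omega
    and f are then carried by the same idempotent, which is what
    f^(omega+star) needs. *)
Lemma flow_monoid_carried f : f \in flow_monoid flows k ->
  f \in closure_ops L /\ exists t, carried f t.
Proof.
pose N := [set f : brel L | (f \in closure_ops L) && `[< exists t, carried f t >]].
have NP g : reflect (g \in closure_ops L /\ exists t, carried g t) (g \in N).
  by rewrite [g \in N]inE; apply: (iffP andP) => -[gC /asboolP gt].
suff NC : flow_closed flows k N.
  by move/bigcapP/(_ N); rewrite asboolT // => /(_ isT)/NP.
split.
- by apply/subsetP => g /NP[].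
- split.
    apply/NP; split; first exact: closure_ops1.
    by exists one => u; rewrite inE oner1 /=.
  apply/subsetP => g gf; apply/NP; split; first exact: (subsetP flowsC).
  exact: flows_carried.
- move=> g h /NP[gC [t gt]] /NP[hC [t' ht']]; apply/NP.
  by split; [exact: closure_opsM | exists (t ** t'); exact: carriedM].
- move=> g /NP[gC [t gt]]; apply/NP; split; first exact: closure_ops_back.
  exists one => u; rewrite oner1 !inE eqxx /=.
  by apply/existsP; exists (F (u ** t)).
move=> g /NP[gC _] [H [K [_ [subK _ [KN ptK] _] gK]]] n n_gt0 _.
pose r := [set p : brel L * M | (p.1 \in N) && `[< carried p.1 p.2 >]].
have rP h t : reflect (h \in N /\ carried h t) ((h, t) \in r).
  by rewrite [_ \in r]inE; apply: (iffP andP) => -[hN /asboolP ht].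
have rmr : relational_morphism N r.
  split=> [[h t] /rP[] // |h hN|[g1 t1] [g2 t2] /rP[/NP[C1 _] ct1] /rP[/NP[C2 _] ct2]].
    by have /NP[_ [t ht]] := hN; exists t; apply/rP.
  have c12 := carriedM ct1 ct2; apply/rP; split=> //; apply/NP.
  by split; [exact: closure_opsM | exists (t1 ** t2)].
have [t tK] := ptK M r class_M rmr.
have [closedK [e eK groupK]] := subK.
have tKn j : {in K, forall h, carried h (spow t j)}.
  elim: j => [|j IHj] h hK; first by have /rP[] := tK h hK.
  have [_ <- _] := groupK h hK; rewrite spowS; apply: carriedM; first exact: IHj.
  by have /rP[] := tK e eK.
have gnK : brel_exp g n \in K.
  case: n n_gt0 => // n _; elim: n => [|n IHn]; last exact: closedK.
  by rewrite /brel_exp /= brel_mulr1.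
have /NP[gnC _] := subsetP KN _ gnK.
have [j idt] := idempotent_spow t.
apply/NP; split.
  by apply: closure_opsM => //; apply: closure_ops_star.
exists (spow t j) => u; apply/brel_mulP.
exists (F (u ** spow t j)); first exact: tKn.
rewrite inE [X in _ && X]inE eqxx andbT -[in X in (_, X)]idt smulA.
exact: tKn.
Qed.

Lemma brel_one_in_flow_monoid : brel_one L \in flow_monoid flows k.
Proof. by apply/bigcapP => N /asboolP[_ []]. Qed.

Lemma flow_monoidM : smul_closed (flow_monoid flows k).
Proof.
move=> f g /bigcapP fF /bigcapP gF; apply/bigcapP => N NC.
by have /asboolP[_ _ closedN _ _] := NC; apply: closedN; [apply: fF | apply: gF].
Qed.

Lemma flow_monoid_back :
  {in flow_monoid flows k, forall f, brel_back f \in flow_monoid flows k}.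
Proof.
move=> f /bigcapP fF; apply/bigcapP => N NC.
by have /asboolP[_ _ _ backN _] := NC; apply/backN/fF.
Qed.

Lemma mem_brel_back (f : brel L) l m :
  ((l, m) \in brel_back f) = (l == m) && (l \in brel_dom f).
Proof. by rewrite inE. Qed.

Lemma mem_vacuum l m :
  ((l, m) \in vacuum flows k) = (l == m) && (l \in vacuum_dom flows k).
Proof.
apply/bigcapP/andP => [lV|[/eqP<- /bigcapP lV] f fF].
  have /lV := brel_one_in_flow_monoid; rewrite mem_brel_back => /andP[eq_lm _].
  split=> //; apply/bigcapP => f /lV; rewrite mem_brel_back.
  by case/andP.
by rewrite mem_brel_back eqxx lV.
Qed.

(** The intersection of partial identities is their product. *)
Lemma vacuum_in_flow_monoid : vacuum flows k \in flow_monoid flows k.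
Proof.
pose V (s : seq (brel L)) : brel L :=
  [set p : L * L | (p.1 == p.2) && all (fun f => p.1 \in brel_dom f) s].
have VF s : {subset s <= flow_monoid flows k} -> V s \in flow_monoid flows k.
  elim: s => [|f s IHs] sF.
    suff -> : V [::] = brel_one L by exact: brel_one_in_flow_monoid.
    by apply/setP => p; rewrite !inE andbT.
  suff -> : V (f :: s) = brel_back f ** V s.
    apply: flow_monoidM; first by apply/flow_monoid_back/sF/mem_head.
    by apply: IHs => g gs; apply: sF; rewrite inE gs orbT.
  apply/setP => -[l m]; apply/idP/brel_mulP.
    rewrite inE /= => /and3P[/eqP <- lf ls]; exists l.
      by rewrite mem_brel_back eqxx.
    by rewrite inE /= eqxx.
  case=> l'; rewrite mem_brel_back => /andP[/eqP <- lf].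
  by rewrite inE /= => /andP[/eqP<- ls]; rewrite inE /= eqxx lf.
suff -> : vacuum flows k = V (enum (flow_monoid flows k)).
  by apply: VF => f; rewrite mem_enum.
apply/setP => -[l m]; rewrite mem_vacuum inE /=; congr (_ && _).
apply/bigcapP/allP => lF f; first by rewrite mem_enum => /lF.
by move=> fF; apply: lF; rewrite mem_enum.
Qed.

Theorem eval_states_bound u0 l : (base <= F u0)%O ->
  l \in eval_states flows base k -> exists u, (l <= F u)%O.
Proof.
move=> base_le /imsetP[_ /imsetP[f fF ->] ->].
set V := vacuum flows k.
have VF := vacuum_in_flow_monoid.
have FV u : F u \in vacuum_dom flows k.
  apply/bigcapP => g /flow_monoid_carried[_ [t gt]].
  by rewrite inE; apply/existsP; exists (F (u ** t)).
have gF : V ** f ** V \in flow_monoid flows k by rewrite !flow_monoidM.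
have [gC [t gt]] := flow_monoid_carried gF.
have [sV _ s_min] := start_state_min base k flowsC.
set s := start_state flows base k in sV s_min *.
have s_dom : s \in brel_dom (V ** f ** V) by move/bigcapP: sV; apply.
have [sg _] := flow_act_min gC s_dom.
have [_ g_min] := flow_act_min gC s_dom.
exists (u0 ** t).
have s_le : (s <= F u0)%O by apply: s_min.
have /closure_opsP[_ gI] := gC.
have := gI _ _ _ _ sg (gt u0); rewrite (Order.MeetTheory.meet_idPl s_le).
by move/g_min; rewrite Order.MeetTheory.lexI => /andP[].
Qed.

End FlowBound.

(** * The action of a group mapping semigroup on an R-class *)

Section GroupMappingFacts.
Variables (S : finSemigroupType) (G : finGroupType) (A B : finType).
Variables (C : B -> A -> option G) (iota : option (A * G * B) -> S) (a0 : A).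
Hypothesis gm : group_mapping C iota.

Let iotaM := gm_morph gm.

Definition rcls (y : G * B) : S := iota (Some (a0, y.1, y.2)).

Lemma rcls_inj : injective rcls.
Proof. by case=> g b [h c] /(gm_inj gm)[-> ->]. Qed.

Lemma iota_ideal u s : exists v, iota u ** s = iota v.
Proof.
have [z _ [[_ idl] _ _]] := gm_zero_minimal gm.
have uI : iota u \in [set iota v | v : option (A * G * B)] by apply: imset_f.
by have [_ /imsetP[v _ ->]] := idl _ uI s; exists v.
Qed.

Lemma iota_None_mul s : iota None ** s = iota None.
Proof.
have [z z0 [[I0 _] _ _]] := gm_zero_minimal gm.
suff -> : iota None = z by rewrite (z0 s).1.
have : z \in [set iota v | v : option (A * G * B)].
  have [_ /imsetP[u _ _]] := set0Pn _ I0; have [v] := iota_ideal u z.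
  by rewrite (z0 _).2 => ->; apply: imset_f.
case/imsetP=> u _ zu; rewrite -[RHS](z0 (iota None)).1 zu -iotaM.
by case: u {zu} => [[[? ?] ?]|].
Qed.

(** Regularity of the sandwich matrix provides an idempotent e in the R-class.
    As e is a left identity there, the elements h e with h in G act on the
    R-class as the left translations. *)
Lemma left_translations : exists lm : G -> S, exists y1 : G * B,
  [/\ (forall h y, lm h ** rcls y = rcls (left_act h y)),
      (forall h, exists y, lm h = rcls y),
      lm 1%g = rcls y1
    & forall h h', lm h ** lm h' = lm (h * h')%g].
Proof.
have [_ /(_ a0)[b1]] := gm_regular gm; case eqc: (C b1 a0) => [c|//] _.
pose lm h := rcls ((h * c^-1)%g, b1).
have lmE h y : lm h ** rcls y = rcls (left_act h y).
  by rewrite /lm /rcls -iotaM /= eqc mulgKV.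
exists lm, (c^-1, b1)%g; split=> //.
- by move=> h; exists ((h * c^-1)%g, b1).
- by rewrite /lm mul1g.
- by move=> h h'; rewrite {2}/lm lmE /lm /left_act /= mulgA.
Qed.

Lemma rcls_trans y z : exists s, rcls y ** s = rcls z.
Proof.
case: y z => g b [h d]; have [/(_ b)[a1] + _] := gm_regular gm.
case eqc: (C b a1) => [c|//] _; exists (iota (Some (a1, ((g * c)^-1 * h)%g, d))).
by rewrite /rcls -iotaM /= eqc mulKVg.
Qed.

Lemma rcls_mul y s : rcls y ** s = iota None \/ exists z, rcls y ** s = rcls z.
Proof.
have [lm [y1 [lmE _ lm1 _]]] := left_translations.
have [v ys] := iota_ideal (Some (a0, y.1, y.2)) s.
have : lm 1%g ** (rcls y ** s) = rcls y ** s.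
  by rewrite smulA lmE /left_act mul1g -surjective_pairing.
rewrite lm1 {1}/rcls ys -iotaM => <-.
case: v {ys} => [[[a g] b]|] /=; last by left.
by case: (C y1.2 a) => [c|]; [right; exists ((y1.1 * c * g)%g, b) | left].
Qed.

Lemma gm_actP y s z : gm_act iota a0 y s = Some z <-> rcls y ** s = rcls z.
Proof.
rewrite /gm_act; case: pickP => [v /eqP ys|no]; split=> //.
- by case=> <-.
- by move=> yz; congr Some; apply: rcls_inj; rewrite /rcls -ys.
by move=> /eqP yz; have := no z; rewrite yz.
Qed.

Lemma left_act_rcls g y s z :
  rcls y ** s = rcls z -> rcls (left_act g y) ** s = rcls (left_act g z).
Proof.
have [lm [_ [lmE _ _ _]]] := left_translations.
by move=> ys; rewrite -!lmE -smulA ys.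
Qed.

(** Faithfulness on one R-class gives faithfulness on every R-class, since the
    R-classes of the 0-minimal ideal are left translates of each other. *)
Lemma rcls_faithful s t : (forall y, rcls y ** s = rcls y ** t) -> s = t.
Proof.
move=> st; have [a faithful] := gm_faithful_right gm; apply: faithful => g b.
have [_ /(_ a0)[b1]] := gm_regular gm; case eqc: (C b1 a0) => [c|//] _.
have -> : iota (Some (a, g, b)) = iota (Some (a, c^-1%g, b1)) ** rcls (g, b).
  by rewrite /rcls -iotaM /= eqc mulVg mul1g.
by rewrite -!smulA st.
Qed.

End GroupMappingFacts.

(** * Partial equivalences and minimal right ideals *)

Lemma sp_of_per (T : finType) (r : rel T) : symmetric r -> transitive r ->
  exists p : SP T, sp_rel p =2 r.
Proof.
move=> sym_r tr_r; pose D := [set x | r x x].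
have refl_r x y : r x y -> x \in D.
  by move=> xy; rewrite inE; apply: (tr_r y); rewrite // sym_r.
have eqr : {in D & &, equivalence_rel r}.
  move=> x y z; rewrite !inE => _ _ zz; split=> // xy.
  by apply/idP/idP => h; [apply: (tr_r x) | apply: (tr_r y)]; rewrite // sym_r.
have part := equivalence_partitionP eqr.
exists (exist (fun p : {set T} * {set {set T}} => partition p.2 p.1)
          (D, equivalence_partition r D) part) => x y.
apply/sp_relP/idP => [[P [/imsetP[z zD ->]]]|xy].
  by rewrite !inE => /andP[_ zx] /andP[_ zy]; apply: (tr_r z); rewrite // sym_r.
have xD := refl_r _ _ xy; have yD : y \in D by apply: (refl_r y x); rewrite sym_r.
exists [set z in D | r x z]; split; first exact: imset_f.
  by rewrite inE xD; move: xD; rewrite inE.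
by rewrite inE yD.
Qed.

(** Choose f such that (e, f) generates a right ideal of least cardinality.
    A right multiple of (e, f) with first component e has an idempotent power
    of the same kind, which by minimality generates the same right ideal, so
    (e, f) is in turn a right multiple of it. *)
Lemma minimal_idempotent (S R : finSemigroupType) (rho : S -> R -> Prop) (e : S) :
    (forall s r s' r', rho s r -> rho s' r' -> rho (s ** s') (r ** r')) ->
    (forall s, exists r, rho s r) -> e ** e = e ->
  exists f, [/\ rho e f, f ** f = f
    & forall s r, rho s r -> (exists s', e ** s ** s' = e) ->
        exists s' r', [/\ rho s' r', e ** s ** s' = e & f ** r ** r' = f]].
Proof.
move=> rhoM total ee.
have rho_spow r n : rho e r -> rho e (spow r n).
  by move=> er; elim: n => // n IHn; rewrite spowS -ee; apply: (rhoM).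
pose ideal f := [set q : S * R | `[< exists s r, rho s r /\ q = (e ** s, f ** r) >]].
pose good n := `[< exists f, [/\ rho e f, f ** f = f & #|ideal f| = n] >].
have ex_good : exists n, good n.
  have [r er] := total e; have [n idn] := idempotent_spow r.
  exists #|ideal (spow r n)|; apply/asboolP; exists (spow r n); split=> //.
  exact: rho_spow.
case: (ex_minnP ex_good) => _ /asboolP[f [ef ff <-]] f_min.
exists f; split=> // s r sr [s1 s1P].
have [r1 sr1] := total s1.
set g := f ** r ** r1.
have eg : rho e g by rewrite -s1P; apply: (rhoM) => //; apply: (rhoM).
have [n idn] := idempotent_spow g.
have [v [w [vw ev fw]]] : exists v w, [/\ rho v w, e ** v = e & spow g n = f ** w].
  elim: n {idn} => [|n [v [w [vw ev fw]]]].
    by exists (s ** s1), (r ** r1); rewrite !smulA; split=> //; apply: (rhoM).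
  exists (v ** e), (w ** g); rewrite smulA ev ee spowS fw smulA; split=> //.
  exact: rhoM.
have sub : ideal (spow g n) \subset ideal f.
  apply/subsetP => _ /[!inE] /asboolP[s2 [r2 [sr2 ->]]]; apply/asboolP.
  by exists (v ** s2), (w ** r2); rewrite !smulA ev -fw; split=> //; apply: (rhoM).
have ideal_eq : ideal (spow g n) = ideal f.
  apply/eqP; rewrite eqEcard sub; apply: f_min; apply/asboolP.
  by exists (spow g n); split=> //; apply: rho_spow.
have : (e, f) \in ideal f.
  by rewrite inE; apply/asboolP; exists e, f; rewrite ee ff.
rewrite -ideal_eq inE => /asboolP[s2 [r2 [sr2 [es2 fr2]]]].
(* doubling the exponent splits off a factor g even if n = 0 *)
have gg : spow g n = g ** spow g (n + n).
  by rewrite -{1}idn spowD spowSl.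
exists (s1 ** (e ** s2)), (r1 ** (spow g (n + n) ** r2)).
rewrite !smulA s1P ee -es2; split=> //; last by rewrite -/g -gg.
by do ![apply: (rhoM) => //]; apply: rho_spow.
Qed.

(** * The flow of an aperiodic relation *)

Section Flow.
Variables (S : finSemigroupType) (G : finGroupType) (A B : finType).
Variables (C : B -> A -> option G) (iota : option (A * G * B) -> S) (a0 : A).
Hypothesis gm : group_mapping C iota.
Variables (H : finGroupType) (X : tsemigroup).

Local Notation M := (adj1 (elements X)).
Local Notation R := (elements (wreath (regular (group_sg H)) (adj1_ts X))).
Local Notation rcls := (rcls iota a0).

Variable rho : S -> R -> Prop.
Hypothesis rhoM : forall s r s' r', rho s r -> rho s' r' -> rho (s ** s') (r ** r').
Hypothesis rho_total : forall s, exists r, rho s r.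
Hypothesis rho_aperiodic : forall s r, rho s r -> r ** r = r -> stable_power s.

Variables (lm : G -> S) (y1 : G * B).
Hypothesis lm_rcls : forall h y, lm h ** rcls y = rcls (left_act h y).
Hypothesis lm_in : forall h, exists y, lm h = rcls y.
Hypothesis lm1 : lm 1%g = rcls y1.
Hypothesis lmM : forall h h', lm h ** lm h' = lm (h * h')%g.

Variable f : R.
Hypothesis ef : rho (lm 1%g) f.
Hypothesis ff : f ** f = f.
Hypothesis f_min : forall s r, rho s r ->
  (exists s', lm 1%g ** s ** s' = lm 1%g) ->
  exists s' r', [/\ rho s' r', lm 1%g ** s ** s' = lm 1%g & f ** r ** r' = f].

Lemma left_act1 (y : G * B) : left_act 1%g y = y.
Proof. by case: y => g b; rewrite /left_act mul1g. Qed.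

Lemma lm_inj : injective lm.
Proof.
move=> h h' /(congr1 (fun s => s ** rcls y1)); rewrite !lm_rcls.
by move/(rcls_inj gm) => [/mulIg].
Qed.

Lemma lm_spow h n : spow (lm h) n = lm (h ^+ n.+1)%g.
Proof. by elim: n => [|n IHn]; rewrite ?expg1 // spowS IHn lmM -expgSr. Qed.

Lemma lm_stable h : stable_power (lm h) -> h = 1%g.
Proof.
case=> n; rewrite !lm_spow => /lm_inj; rewrite expgSr -[RHS]mulg1.
exact: mulgI.
Qed.

Lemma wreath1E (r r' : R) p : (r ** r').1 p = (r.1 p * r'.1 (tact p r.2))%g.
Proof. by rewrite ffunE. Qed.

(** The elements of the R-class of (e, f) in the relation, where e = lm 1. *)
Definition reach (y : G * B) (r : R) : Prop := rho (rcls y) r /\ f ** r = r.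

Lemma reach_back y r : reach y r ->
  exists s u, [/\ rho s u, rcls y ** s = lm 1%g & r ** u = f].
Proof.
case=> yr fr; have [s' ys'] := rcls_trans a0 gm y y1.
have ey : lm 1%g ** rcls y = rcls y by rewrite lm_rcls left_act1.
have [|s [u [su]]] := f_min yr; first by exists s'; rewrite ey ys' lm1.
by rewrite ey fr; exists s, u.
Qed.

Lemma reach_mul y r s u z : reach y r -> rho s u -> rcls y ** s = rcls z ->
  reach z (r ** u).
Proof.
by move=> [yr fr] su ys; rewrite /reach -ys smulA fr; split=> //; apply: rhoM.
Qed.

Definition below (m m' : M) : Prop := exists a, m = a ** m'.

Lemma below_refl m : below m m.
Proof. by exists None; rewrite adj1_mul1. Qed.

Lemma below_trans m m' m'' : below m m' -> below m' m'' -> below m m''.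
Proof. by move=> [a ->] [b ->]; exists (a ** b); rewrite smulA. Qed.

Lemma below_mul m m' w : below m m' -> below (m ** w) (m' ** w).
Proof. by case=> a ->; exists a; rewrite smulA. Qed.

(** As r0 u r0 = r0, the H-coordinates of u r0 that r0 meets are trivial.
    Those that r meets are among them, r.2 being in the left ideal of r0.2. *)
Lemma absorb (r0 r u : R) :
  r0 ** u = f -> f ** r0 = r0 -> below r.2 r0.2 -> r ** (u ** r0) = r.
Proof.
move=> r0u fr0 [a ra]; have rur : r0 ** (u ** r0) = r0 by rewrite smulA r0u.
apply/pair_eqP/andP; split; apply/eqP; last first.
  change (r.2 ** (u ** r0).2 = r.2); rewrite ra -smulA; congr (_ ** _).
  exact: (congr1 snd rur).
apply/ffunP => p; rewrite wreath1E ra tactM.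
have : (r0 ** (u ** r0)).1 (tact p a) = r0.1 (tact p a) by rewrite rur.
by rewrite wreath1E -[RHS]mulg1 => /mulgI ->; rewrite mulg1.
Qed.

(** Both r and r' are read at y', so they differ by left multiplication by an
    element of the relation whose first component is e.  As e is a left
    identity on the R-class, this element also moves (y, r) to (y, r'). *)
Lemma reach_exchange y y' r r' : reach y r -> reach y' r -> reach y' r' ->
  below r'.2 r.2 -> reach y r'.
Proof.
move=> [yr fr] y'r [y'r' fr'] r'_below.
have [s [u [su y's ru]]] := reach_back y'r.
split=> //; rewrite -(absorb ru fr r'_below) smulA -(left_act1 y) -lm_rcls.
apply: rhoM => //.
by rewrite -y's; apply: rhoM.
Qed.

(** Here aperiodicity enters: leading (g, b) back to e at r leads (h, b) to the
    translate of e by h g^-1, which is then related to the idempotent f. *)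
Lemma reach_cross_section g h b r : reach (g, b) r -> reach (h, b) r -> g = h.
Proof.
move=> gr [hr _]; have [s [u [su gs ru]]] := reach_back gr.
have : rho (rcls (h, b) ** s) (r ** u) by apply: rhoM.
have -> : rcls (h, b) = lm (h * g^-1)%g ** rcls (g, b).
  by rewrite lm_rcls /left_act /= mulgKV.
rewrite -smulA gs lmM mulg1 ru => /rho_aperiodic/(_ ff)/lm_stable /eqP.
by rewrite -eq_mulgV1 => /eqP ->.
Qed.

(** The H-coordinate is cancellable.  So is the monoid coordinate within the
    left ideal of r.2: since r x can be led back to f, an element a with
    a r.2 x = r.2 x fixes f.2, and therefore r.2. *)
Lemma reach_cancel y y' z r r' s x : reach y r -> reach y' r' -> rho s x ->
  rcls y ** s = rcls z -> r ** x = r' ** x -> below r'.2 r.2 -> r' = r.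
Proof.
move=> yr [_ fr'] sx ys rx [a r'a].
have [s' [w [_ _ rxw]]] := reach_back (reach_mul yr sx ys).
have [_ fr] := yr.
have af : a ** f.2 = f.2.
  transitivity (r' ** x ** w).2; last by rewrite -rx rxw.
  by rewrite -rxw /= r'a !smulA.
have r'2 : r'.2 = r.2.
  by rewrite r'a -{1}fr -[(f ** r).2]/(f.2 ** r.2) smulA af -{2}fr.
apply/pair_eqP/andP; split; apply/eqP => //.
apply/ffunP => p; have : (r ** x).1 p = (r' ** x).1 p by rewrite rx.
by rewrite !wreath1E r'2 => /mulIg.
Qed.

(** If u is any lift of lm h then so is v = f u f, and v is a unit of fRf,
    because it can be led back to f by a multiplication on the right. *)
Lemma left_lift h : exists v v', [/\ rho (lm h) v, f ** v = v & v' ** v = f].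
Proof.
have [u hu] := rho_total (lm h).
have [y hy] := lm_in h.
have hv : rho (lm h) (f ** u ** f).
  by rewrite -[h in lm h]mulg1 -[h in lm (h * _)]mul1g -!lmM; do ![apply: (rhoM) => //].
have yv : reach y (f ** u ** f) by split; rewrite -?hy // !smulA ff.
have [s [w [_ _ vw]]] := reach_back yv.
have vf : f ** u ** f ** f = f ** u ** f by rewrite -smulA ff.
move: (f ** u ** f) hv yv vw vf => v hv yv vw vf.
have fv : f ** v = v by case: yv.
have [n idv] := idempotent_spow v.
exists v, (spow v (n + n)); split=> //.
have vnf j : spow v j ** f = spow v j.
  by case: j => [|j]; [exact: vf | rewrite spowS -smulA vf].
(* a right inverse of v in the finite monoid fRf makes v a unit *)
have vnw : spow v n ** spow (w ** f) n = f.
  elim: n {idv} => [|j IHj]; first by rewrite smulA vw ff.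
  by rewrite spowS spowSl !smulA -(smulA _ v) vw !vnf.
have vn : spow v n = f by rewrite -[LHS]vnf -{1}vnw smulA idv.
by rewrite -spowS -spowD vn ff.
Qed.

Lemma reach_left h y r : reach y r -> exists v v',
  [/\ rho (lm h) v, f ** v = v, v' ** v = f & reach (left_act h y) (v ** r)].
Proof.
case=> yr _; have [v [v' [hv fv vv]]] := left_lift h; exists v, v'; split=> //.
by split; rewrite ?smulA ?fv // -lm_rcls; apply: rhoM.
Qed.

(** The states that a point u of the monoid stands for are those read at some
    element of the L-class of u.  With u alone instead of its L-class the
    relation need not be G-invariant, since lifts of left translations move u. *)
Definition same (u : M) : rel (G * B) := fun y y' =>
  `[< exists r : R, [/\ below r.2 u, below u r.2, reach y r & reach y' r] >].

Lemma same_sym u : symmetric (same u).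
Proof.
move=> y y'; apply/asboolP/asboolP => -[r [ru ur yr y'r]]; by exists r.
Qed.

Lemma same_trans u : transitive (same u).
Proof.
move=> y' y y'' /asboolP[r [ru ur yr y'r]] /asboolP[r' [r'u ur' y'r' y''r']].
apply/asboolP; exists r'; split=> //; apply: reach_exchange yr y'r y'r' _.
exact: below_trans r'u ur.
Qed.

Definition flow_sp u : SP (G * B)%type :=
  sval (cid (sp_of_per (@same_sym u) (@same_trans u))).

Lemma flow_spE u y y' : sp_rel (flow_sp u) y y' = same u y y'.
Proof. exact: (svalP (cid (sp_of_per (@same_sym u) (@same_trans u)))). Qed.

Lemma flow_sp_inv u : invariant_sp (flow_sp u) && cross_section (flow_sp u).
Proof.
apply/andP; split.
  apply/invariant_spP => g y y'; rewrite !flow_spE => /asboolP[r [ru ur yr y'r]].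
  have [v [v' [hv fv vv yvr]]] := reach_left g yr.
  apply/asboolP; exists (v ** r); split=> //.
  - by apply: below_trans ru; exists v.2.
  - apply: below_trans ur _; exists v'.2.
    have rE : v' ** (v ** r) = r by rewrite smulA vv; case: yr.
    exact: (congr1 snd (esym rE)).
  have [_ _] := y'r; split; last by rewrite smulA fv.
  by rewrite -lm_rcls; apply: rhoM => //; case: y'r.
apply/cross_sectionP => g h b; rewrite flow_spE => /asboolP[r [_ _ gr hr]].
exact: reach_cross_section gr hr.
Qed.

Definition flow u : inv_cross_section G B := Sub (flow_sp u) (flow_sp_inv u).

Lemma flow_suppP u y :
  reflect (exists r : R, [/\ below r.2 u, below u r.2 & reach y r])
          (y \in sp_supp (flow_sp u)).
Proof.
rewrite sp_suppE flow_spE.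
by apply: (iffP (asboolP _)) => [[r [ru ur yr _]]|[r [ru ur yr]]]; exists r.
Qed.

Lemma flow_step s : exists w, forall u,
  free_flow_cond iota a0 s (val (flow u)) (val (flow (u ** w))).
Proof.
have [x sx] := rho_total s; exists x.2 => u; rewrite !SubK.
have step y z (r : R) : below r.2 u -> below u r.2 -> reach y r ->
    rcls y ** s = rcls z ->
    [/\ below (r ** x).2 (u ** x.2), below (u ** x.2) (r ** x).2
      & reach z (r ** x)].
  by move=> ru ur yr ys; split; [exact: below_mul | exact: below_mul | exact: reach_mul ys].
apply/andP; split.
  apply/forall_inP => y /flow_suppP[r [ru ur yr]]; apply/forallP => z.
  apply/implyP => /eqP/(gm_actP a0 gm) ys.
  by apply/flow_suppP; exists (r ** x); apply: step ys.
apply/forall_inP => y /flow_suppP[r [ru ur yr]].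
apply/forall_inP => y' /flow_suppP[r' [r'u ur' y'r']].
apply/forallP => z; apply/forallP => z'.
apply/implyP => /andP[/eqP/(gm_actP a0 gm) ys /eqP/(gm_actP a0 gm) y's].
rewrite !flow_spE; apply/eqP; apply/idP/idP => /asboolP[r0 [r0u ur0 yr0 y'r0]].
  have [ru1 ur1 zr1] := step _ _ _ r0u ur0 yr0 ys.
  by apply/asboolP; exists (r0 ** x); split=> //; apply: reach_mul y's.
have [rxu uxr zrx] := step _ _ _ ru ur yr ys.
have [r'xu uxr' z'r'x] := step _ _ _ r'u ur' y'r' y's.
have z'rx : reach z' (r ** x).
  by apply: reach_exchange y'r0 yr0 zrx _; apply: below_trans rxu ur0.
have [s' [v [s'v z's' r'xv]]] := reach_back z'r'x.
have [[_ fr'x] [_ frx]] := (z'r'x, z'rx).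
(* r ** x = r1 ** x with r1 read at y', so that r1 = r *)
pose r1 := r ** x ** v ** r'.
have r1x : r ** x = r1 ** x.
  rewrite /r1 -[in RHS](smulA _ r') -[in RHS](smulA _ v).
  by rewrite (absorb r'xv fr'x) //; apply: below_trans rxu uxr'.
have y'r1 : reach y' r1.
  split; last by rewrite /r1 !smulA; have [_ ->] := yr.
  have -> : rcls y' = lm 1%g ** rcls y' by rewrite lm_rcls left_act1.
  apply: rhoM; last by case: y'r'.
  by rewrite -z's'; apply: rhoM => //; case: z'rx.
apply/asboolP; exists r; split=> //.
suff <- : r1 = r by [].
apply: reach_cancel yr y'r1 sx ys r1x _.
by apply: below_trans ur; apply: below_trans r'u; exists (r ** x ** v).2.
Qed.

Lemma flow_start b : exists u, forall g, (g, b) \in sp_supp (val (flow u)).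
Proof.
have [s y1s] := rcls_trans a0 gm y1 (1%g, b); have [x sx] := rho_total s.
have br : reach (1%g, b) (f ** x).
  by split; rewrite ?smulA ?ff // -y1s -lm1; apply: rhoM.
exists (f ** x).2 => g; rewrite SubK.
have /andP[/invariant_spP inv _] := flow_sp_inv (f ** x).2.
have -> : (g, b) = left_act g (1%g, b) by rewrite /left_act mulg1.
rewrite sp_suppE; apply: inv; rewrite -sp_suppE.
by apply/flow_suppP; exists (f ** x); split=> //; apply: below_refl.
Qed.

End Flow.

(** One half of the presentation lemma.  The states of the flow are the elements
    of a monoid, which acts on them by right multiplication; to say which w
    carries the free flow along s it is enough to lift s to the semidirect
    product. *)
Theorem aperiodic_flow (S : finSemigroupType) (G : finGroupType) (A B : finType)
    (C : B -> A -> option G) (iota : option (A * G * B) -> S) (a0 : A)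
    (H : finGroupType) (X : tsemigroup)
    (rho : S -> elements (wreath (regular (group_sg H)) (adj1_ts X)) -> Prop) :
    group_mapping C iota ->
    (forall s r s' r', rho s r -> rho s' r' -> rho (s ** s') (r ** r')) ->
    (forall s, exists r, rho s r) ->
    (forall s r, rho s r -> r ** r = r -> stable_power s) ->
  exists F : adj1 (elements X) -> inv_cross_section G B,
    (forall s, exists w, forall u,
       free_flow_cond iota a0 s (val (F u)) (val (F (u ** w)))) /\
    (forall b, exists u, forall g, (g, b) \in sp_supp (val (F u))).
Proof.
move=> gm rhoM rho_total rho_ap.
have [lm [y1 [lm_rcls lm_in lm1 lmM]]] := left_translations a0 gm.
have [|f [ef ff f_min]] := @minimal_idempotent _ _ rho (lm 1%g) rhoM rho_total.
  by rewrite lmM mulg1.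
exists (flow gm rhoM rho_total rho_ap lm_rcls lm_in lm1 lmM ef ff f_min).
split; [exact: flow_step | exact: flow_start].
Qed.

(** * The lower bound *)

Lemma KR_divides_complexity (U : finSemigroupType) (P : {set U}) n :
  KR_divides P n -> exists2 m, (m <= n)%N & complexity P m.
Proof.
move=> Pn; have ex : exists m, `[< KR_divides P m >] by exists n; apply/asboolP.
case: (ex_minnP ex) => m /asboolP Pm m_min; exists m.
  by apply/m_min/asboolP.
by split=> // j Pj; apply/m_min/asboolP.
Qed.

Lemma adj1_complexity_class n X : KR_wreath n X ->
  complexity_class n (adj1 (elements X)).
Proof.
move=> /KR_covering[Y KRY /covering_divides XY].
by apply: KR_divides_complexity; exists Y.
Qed.

Lemma divides_onto (U T : finSemigroupType) : divides [set: U] T ->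
  exists (D : {set T}) (h : T -> U),
    [/\ smul_closed D, {in D &, {morph h : x y / x ** y}},
        (forall u, exists2 d, d \in D & h d = u)
      & {in D, forall d, stable_power d -> stable_power (h d)}].
Proof.
case=> D [h [closedD morh imD]]; exists D, h; split=> //.
  move=> u; have : u \in h @: D by rewrite imD in_setT.
  by case/imsetP=> d dD ->; exists d.
move=> d dD [n eq_n]; exists n.
have hD j : spow d j \in D /\ h (spow d j) = spow (h d) j.
  elim: j => // j [jD IHj]; split; first exact: closedD.
  by rewrite !spowS morh // IHj.
by have [_ <-] := hD n.+1; have [_ <-] := hD n; rewrite eq_n.
Qed.

Section LowerBound.
Variables (S : finSemigroupType) (G : finGroupType) (A B : finType).
Variables (C : B -> A -> option G) (iota : option (A * G * B) -> S) (a0 : A).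
Hypothesis gm : group_mapping C iota.

Lemma GM_not_aperiodic (X : tsemigroup) :
  KR_wreath 0 X -> ~ divides [set: S] (elements X).
Proof.
move KR0: 0%N => n KRX; case: n X / KRX KR0 => // T /stable_powerP apT _.
case/divides_onto=> D [h [_ _ onto stD]].
have [lm [y1 [lm_rcls _ _ lmM]]] := left_translations a0 gm.
have := gm_nontrivial gm; suff -> : [set: G] = [set 1%g] by rewrite cards1.
apply/setP => g; rewrite !inE; apply/esym/eqP.
apply: (lm_stable gm y1 lm_rcls lmM).
by have [d dD <-] := onto (lm g); apply: stD.
Qed.

Lemma wreath_flow (T : finSemigroupType) (H : finGroupType) (X : tsemigroup) :
    aperiodic T ->
    divides [set: S] (elements (wreath (regular T) (wreath (regular (group_sg H)) X))) ->
  exists F : adj1 (elements X) -> inv_cross_section G B,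
    (forall s, exists w, forall u,
       free_flow_cond iota a0 s (val (F u)) (val (F (u ** w)))) /\
    (forall b, exists u, forall g, (g, b) \in sp_supp (val (F u))).
Proof.
move=> apT /divides_onto[D [h [closedD morh onto stD]]].
pose emb (r : elements (wreath (regular (group_sg H)) X)) :
  elements (wreath (regular (group_sg H)) (adj1_ts X)) := (r.1, Some r.2).
have embM r r' : emb (r ** r') = emb r ** emb r' by [].
have emb_inj : injective emb by case=> [g t] [g' t'] [-> ->].
pose rho s r := exists2 d, d \in D & h d = s /\ emb d.2 = r.
apply: (@aperiodic_flow _ _ _ _ _ _ _ H X rho gm).
- move=> _ _ _ _ [d dD [<- <-]] [d' d'D [<- <-]].
  by exists (d ** d'); rewrite ?closedD // morh //.
- by move=> s; have [d dD <-] := onto s; exists (emb d.2); exists d.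
move=> _ _ [d dD [<- <-]]; rewrite -embM => /emb_inj dd; apply: stD => //.
exact: wreath_stable_power apT dd.
Qed.

Lemma no_contradiction k n X (F : adj1 (elements X) -> inv_cross_section G B)
    (Y : {set S}) (b0 : B) :
    KR_wreath n X -> (n <= k)%N ->
    (forall s, exists w, forall u,
       free_flow_cond iota a0 s (val (F u)) (val (F (u ** w)))) ->
    (forall b, exists u, forall g, (g, b) \in sp_supp (val (F u))) ->
  (forall p, p \in sp_states iota a0 Y b0 k -> ~ sp_contradiction p) /\
  (forall u, u \in rh_states iota a0 Y b0 k -> ~ rh_contradiction u).
Proof.
move=> KRX le_nk step start.
have classX : complexity_class k (adj1 (elements X)).
  have [m le_mn cm] := adj1_complexity_class KRX.
  by exists m => //; apply: leq_trans le_nk.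
have [u0 startu] := start b0.
have discrete_le (D : {set G * B}) : (forall y, y \in D -> y.2 = b0) ->
    (sp_discrete D <= val (F u0))%O.
  move=> D_b0; apply/sp_leP => x y /sp_relP[P [/imsetP[[g b] /D_b0 /= -> ->]]].
  by rewrite !inE => /eqP-> /eqP->; rewrite -sp_suppE.
split=> [p|u].
  have flowsC : [set sp_free_flow iota a0 x | x in Y] \subset closure_ops _.
    by apply/subsetP => _ /imsetP[x _ ->]; apply: sp_free_flow_closure.
  have carr : {in [set sp_free_flow iota a0 x | x in Y],
      forall f, exists t, carried (fun u => val (F u)) f t}.
    move=> _ /imsetP[x _ ->]; have [w xw] := step x.
    by exists w => u; rewrite inE; apply: xw.
  have base_le : (sp_discrete [set (1%g, b0)] <= val (F u0))%O.
    by apply: discrete_le => y; rewrite inE => /eqP->.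
  case/(eval_states_bound (@adj1_mulr1 _) classX flowsC carr base_le) => u p_le.
  apply/negP; rewrite negbK; apply/cross_sectionP => g h b /(sp_leP _ _ p_le).
  by have /andP[_ /cross_sectionP cs] := valP (F u); apply: cs.
have flowsC : [set rh_free_flow iota a0 x | x in Y] \subset closure_ops _.
  by apply/subsetP => _ /imsetP[x _ ->]; apply: rh_free_flow_closure.
have carr : {in [set rh_free_flow iota a0 x | x in Y],
    forall f, exists t, carried (fun u => Some (F u) : Rh G B) f t}.
  move=> _ /imsetP[x _ ->]; have [w xw] := step x.
  by exists w => v; rewrite inE; apply: xw.
have base_le : (rh_start b0 <= (Some (F u0) : Rh G B))%O.
  by apply: discrete_le => y; rewrite inE => /eqP->.
case/(eval_states_bound (@adj1_mulr1 _) classX flowsC carr base_le) => v u_le.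
by move=> u_top; move: u_le; rewrite u_top.
Qed.

End LowerBound.

(** * The upper bound *)

Lemma unit_mulA : associative (fun _ _ : unit => tt).
Proof. by []. Qed.
HB.instance Definition _ := isFinSemigroup.Build unit unit_mulA.

Lemma unit_aperiodic : aperiodic unit.
Proof. by apply/stable_powerP => -[]; exists 0%N. Qed.

Lemma divides_wreath (U T : finSemigroupType) (P : {set U}) (Y : tsemigroup) (a : T) :
  divides P (elements Y) -> divides P (elements (wreath (regular T) Y)).
Proof.
case=> D [h [closedD morh imD]].
exists [set w : elements (wreath (regular T) Y) | w.2 \in D], (fun w => h w.2); split.
- by move=> w w'; rewrite !inE; apply: closedD.
- by move=> w w'; rewrite !inE; apply: morh.
apply/setP => u; rewrite -imD; apply/imsetP/imsetP => -[w wD ->].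
  by exists w.2 => //; move: wD; rewrite inE.
by exists ([ffun=> a], w); rewrite ?inE.
Qed.

Section UpperBound.
Variables (S : finSemigroupType) (G : finGroupType) (A B : finType).
Variables (C : B -> A -> option G) (iota : option (A * G * B) -> S) (a0 : A).
Hypothesis gm : group_mapping C iota.
Local Notation rcls := (rcls iota a0).
Local Notation rlm := (rlm iota a0).

Variant rcls_mul_spec b s : option B -> Prop :=
| RclsMulZero of rcls (1%g, b) ** s = iota None : rcls_mul_spec b s None
| RclsMul g c of rcls (1%g, b) ** s = rcls (g, c) : rcls_mul_spec b s (Some c).

Lemma rcls_neq_zero y : rcls y <> iota None.
Proof. by move/(gm_inj gm). Qed.

Lemma rlmP b s : rcls_mul_spec b s (rlm s b).
Proof.
rewrite ffunE; have [bs|[[g c] bs]] := rcls_mul a0 gm (1%g, b) s; last first.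
  by have /(gm_actP a0 gm) -> := bs; apply: RclsMul bs.
case act_bs: (gm_act iota a0 (1%g, b) s) => [z|]; last exact: RclsMulZero.
by have /(gm_actP a0 gm) := act_bs; rewrite bs => /esym/rcls_neq_zero.
Qed.

Lemma rlmE b s g c : rcls (1%g, b) ** s = rcls (g, c) -> rlm s b = Some c.
Proof.
case: rlmP => [-> /esym/rcls_neq_zero //|g' c' -> /(rcls_inj gm)[_ ->] //].
Qed.

Lemma rcls_translate g b s h c :
  rcls (1%g, b) ** s = rcls (h, c) -> rcls (g, b) ** s = rcls ((g * h)%g, c).
Proof. by move/(left_act_rcls gm g); rewrite /left_act /= mulg1. Qed.

Lemma rcls_untranslate g b s h c :
  rcls (g, b) ** s = rcls (h, c) -> rcls (1%g, b) ** s = rcls ((g^-1 * h)%g, c).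
Proof. by move/(left_act_rcls gm g^-1%g); rewrite /left_act /= mulVg. Qed.

Lemma rlmM s t : rlm (s ** t) = rlm s ** rlm t.
Proof.
apply/ffunP => b; rewrite [RHS]ffunE; case: (rlmP b s) => [bs|g c bs] /=.
  case: rlmP => // g c; rewrite smulA bs (iota_None_mul gm).
  by move/esym/rcls_neq_zero.
case: (rlmP c t) => [ct|h d ct]; last first.
  by apply: (rlmE (g := (g * h)%g)); rewrite smulA bs; apply: rcls_translate.
by case: rlmP => // h d; rewrite smulA bs => /rcls_untranslate; rewrite ct =>
  /esym/rcls_neq_zero.
Qed.

Section Division.
Variables (X Y : tsemigroup) (D : {set elements X}) (h : elements X -> ptrans B).
Hypothesis closedD : smul_closed D.
Hypothesis morh : {in D &, {morph h : x y / x ** y}}.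
Hypothesis imD : h @: D = RLM iota a0.
Variables (eta : elements Y -> adj1 (elements X) -> Prop).
Variables (zeta : states Y -> adj1 (elements X) -> Prop) (q1 : states Y).
Hypothesis eta_fun : forall d m m', eta d m -> eta d m' -> m = m'.
Hypothesis zeta_fun : forall q m m', zeta q m -> zeta q m' -> m = m'.
Hypothesis eta_onto : forall m, exists d, eta d m.
Hypothesis zeta1 : zeta q1 None.
Hypothesis eta_zeta : forall d m, eta d m ->
  (forall d' m', eta d' m' -> eta (d ** d') (m ** m')) /\
  (forall q m', zeta q m' -> zeta (tact q d) (m' ** m)).

Definition moves (m : adj1 (elements X)) (b b' : B) : Prop :=
  if m is Some t then t \in D /\ h t b = Some b' else b = b'.

Lemma moves_fun m b b' b'' : moves m b b' -> moves m b b'' -> b' = b''.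
Proof. by case: m => [t [_ hb] [_]|<- <-] //; rewrite hb => -[]. Qed.

Local Notation GB := {dffun forall _ : B, G}.
Local Notation W := (wreath (regular (group_sg GB)) Y).

(** The B-tuple of group elements stored by the group coordinate is updated
    at b by what s contributes at the point that b has moved to so far, which
    can be looked up in the state of Y. *)
Definition represents (w : elements W) (s : S) : Prop :=
  exists t, [/\ t \in D, eta w.2 (Some t), h t = rlm s
    & forall q m b b' g c, zeta q m -> moves m b b' ->
        rcls (1%g, b') ** s = rcls (g, c) -> (w.1 q : GB) b = g].

Lemma represents_fun w s s' : represents w s -> represents w s' -> s = s'.
Proof.
case=> t [_ wt ht ws] [t' [_ wt' ht' ws']].
have [tt'] := eta_fun wt wt'; subst t'.
apply: (rcls_faithful gm (a0 := a0)) => -[g b].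
have [lm [_ [lmE _ _ _]]] := left_translations a0 gm.
have -> : rcls (g, b) = lm g ** rcls (1%g, b) by rewrite lmE /left_act /= mulg1.
rewrite -!smulA; congr (_ ** _).
have : rlm s b = rlm s' b by rewrite -ht ht'.
case: rlmP => [bs|k c bs].
  by case: rlmP => // bs' _; rewrite bs bs'.
case: rlmP => // k' c' bs' [cc']; rewrite bs bs' -cc'.
by rewrite -(ws q1 None b b _ _ zeta1 erefl bs) (ws' q1 None b b _ _ zeta1 erefl bs').
Qed.

Lemma representsM w s w' s' :
  represents w s -> represents w' s' -> represents (w ** w') (s ** s').
Proof.
case=> t [tD wt ht ws] [t' [t'D wt' ht' ws']]; exists (t ** t'); split.
- exact: closedD.
- exact: (eta_zeta wt).1 wt'.
- by rewrite morh // ht ht' rlmM.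
move=> q m b b' g c qm bb' b'ss'; rewrite ffunE.
have [b's|[[k c'] b's]] := rcls_mul a0 gm (1%g, b') s.
  by move: b'ss'; rewrite smulA b's (iota_None_mul gm) => /esym/rcls_neq_zero.
have c's' : rcls (1%g, c') ** s' = rcls ((k^-1 * g)%g, c).
  by apply: rcls_untranslate; rewrite -b's -smulA.
have bc' : moves (m ** Some t) b c'.
  have hc' : h t b' = Some c' by rewrite ht; apply: rlmE b's.
  case: m bb' {qm} => [t0 [t0D hb]|->] //=.
  by split; [exact: closedD | rewrite morh // ffunE hb].
have := ws _ _ _ _ _ _ qm bb' b's.
have := ws' _ _ _ _ _ _ ((eta_zeta wt).2 _ _ qm) bc' c's'.
by rewrite ffunE => -> ->; rewrite mulKVg.
Qed.

Lemma represents_onto s : exists w, represents w s.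
Proof.
have : rlm s \in h @: D by rewrite imD; apply: imset_f.
case/imsetP=> t tD ht; have [d dt] := eta_onto (Some t).
pose val_at q b g := exists m b' c,
  [/\ zeta q m, moves m b b' & rcls (1%g, b') ** s = rcls (g, c)].
pose F q : GB := [ffun b =>
  if pselect (exists g, val_at q b g) is left e then sval (cid e) else 1%g].
exists ([ffun q => F q], d), t; split=> // q m b b' g c qm bb' b's.
rewrite !ffunE; case: pselect => [e|]; last by case; exists g, m, b', c.
have [m' [b'' [c' [qm' bb'' b''s]]]] := svalP (cid e).
move: bb''; rewrite -(zeta_fun qm qm') => bb''.
move: b''s; rewrite -(moves_fun bb' bb'') b's.
by move/(rcls_inj gm) => [].
Qed.

Lemma divides_of_covering : divides [set: S] (elements W).
Proof.
apply: (@divides_rel _ _ _ represents (iota None)).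
- exact: represents_fun.
- exact: representsM.
- by move=> w s _; rewrite in_setT.
by move=> s _; apply: represents_onto.
Qed.

End Division.

Lemma KR_divides_RLM n : KR_divides (RLM iota a0) n -> KR_divides [set: S] n.+1.
Proof.
case=> X KRX [D [h [closedD morh imD]]].
have [Y KRY [eta [zeta [q1 [f_eta f_zeta onto z1 hom]]]]] := KR_covering KRX.
have divW := divides_of_covering closedD morh imD f_eta f_zeta onto z1 hom.
exists (wreath (regular unit)
          (wreath (regular (group_sg {dffun forall _ : B, G})) Y)).
  exact: KR_wreathS unit_aperiodic KRY.
exact: divides_wreath tt divW.
Qed.

End UpperBound.

(** * The complexity of S *)

Theorem theorem2p23 (k : nat) (S : finSemigroupType) (G : finGroupType)
    (A B : finType) (C : B -> A -> option G) (iota : option (A * G * B) -> S)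
    (a0 : A) (b0 : B) (X : {set S}) :
  (1 <= k)%N ->
  group_mapping C iota ->
  generates X ->
  complexity (RLM iota a0) k ->
  (exists2 p, p \in sp_states iota a0 X b0 k.-1 & sp_contradiction p) \/
  (exists2 u, u \in rh_states iota a0 X b0 k.-1 & rh_contradiction u) ->
  complexity [set: S] k.+1.
Proof.
move=> k_gt0 gm _ [RLM_k _] contradiction.
split=> [|m [Z KRZ divZ]]; first exact: (KR_divides_RLM gm RLM_k).
rewrite ltnNge; apply/negP => le_mk.
case: m Z / KRZ divZ le_mk => [T apT|n Z T H apT KRZ] divZ le_nk.
  by apply: (GM_not_aperiodic a0 gm) divZ; apply: KR_wreath0.
have [F [step start]] := wreath_flow a0 gm apT divZ.
have le_n : (n <= k.-1)%N by rewrite -ltnS prednK.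
have [noSP noRh] := no_contradiction X b0 KRZ le_n step start.
by case: contradiction => [[p /noSP]|[u /noRh]].
Qed.
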